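(* Let $(Q,I)$ be a complete gentle quiver, $k$ a field, and let $\Lambda$ be the ribbon graph order given by the arrow ideal completion of the path algebra $kQ/I$. Then the derived Nakayama functor $\nu_\Lambda$ is induced by some involution $\varepsilon^\star$ of the order $\Lambda$, that is, there are an involution $\varepsilon^\star$ of $\Lambda$ and an isomorphism of functors $\nu_\Lambda \cong (-)_{\varepsilon^\star}$ on $D^-(\mathrm{mod}\,\Lambda)$. Consequently there are isomorphisms of functors $\mathbb{S}_\Lambda \cong (-)_{\varepsilon^\star}\circ [1]$ and $\mathbb{S}_\Lambda^2 \cong [2]$.
   Context: $k$ is a field, $R = k[[t]]$. All modules are finitely generated left modules. Paths are composed from right to left: $ba$ means first $a$, then $b$; products of non-composable arrows are zero. A finite quiver with relations $(Q,I)$ is complete gentle if (1) there are exactly two arrows starting and exactly two arrows ending at each vertex; (2) for any arrow $b\in Q_1$ there are unique arrows $a,c\in Q_1$ such that $cb\notin I$ and $ba\notin I$; (3) the ideal $I$ is generated by paths of length two. For $a\in Q_1$ let $\sigma(a)$ be the unique arrow with $\sigma(a)a\notin I$; this defines a permutation $\sigma$ of $Q_1$. Let $n(a)$ be the length of the $\sigma$-orbit of $a$ and $c_a=\sigma^{n(a)-1}(a)\cdots\sigma(a)a$ the repetition-free cyclic path starting with $a$. $\Lambda$ is viewed as an $R$-order (an $R$-algebra which is free of finite rank as an $R$-module) via the morphism $R\to\Lambda$, $t\mapsto\sum_{a\in Q_1}c_a$. An involution of $\Lambda$ is an $R$-algebra automorphism whose square is the identity. The canonical bimodule is $\Lambda^\vee=\mathrm{Hom}_R(\Lambda,R)$.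 The derived Nakayama functor is $\nu_\Lambda=\Lambda^\vee\otimes^{\mathbb{L}}_\Lambda - : D^-(\mathrm{mod}\,\Lambda)\to D^-(\mathrm{mod}\,\Lambda)$ on the right-bounded derived category of finitely generated $\Lambda$-modules, and the relative Serre functor is $\mathbb{S}_\Lambda=\nu_\Lambda\circ[1]$. For an involution $\varepsilon^\star$ of $\Lambda$, let $\Lambda_{\varepsilon^\star}$ be the $\Lambda$-bimodule $\Lambda$ with the regular left module structure and with right module structure $a\star b=a\,\varepsilon^\star(b)$; the functor $(-)_{\varepsilon^\star}$ is $\Lambda_{\varepsilon^\star}\otimes_\Lambda -$. *)

(* Defs.v *)
(* MathComp world, with the classical axioms of mathcomp.classical.boolp. *)
From HB Require Import structures.
From mathcomp Require Import all_boot all_order all_algebra.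
From mathcomp Require Import boolp.

Set Implicit Arguments.
Unset Strict Implicit.
Unset Printing Implicit Defensive.

Import GRing.Theory Num.Theory.
Local Open Scope ring_scope.

Section Triangular.
Variable (V : nmodType).

Lemma sum_triangle (n : nat) (F : nat -> nat -> V) :
  \sum_(j < n.+1) \sum_(i < j.+1) F i j =
  \sum_(i < n.+1) \sum_(j < (n - i).+1) F i (i + j)%N.
Proof.
pose G i j := F i (i + j)%N.
have -> : \sum_(j < n.+1) \sum_(i < j.+1) F i j =
          \sum_(j < n.+1) \sum_(i < j.+1) G i (j - i)%N.
  by apply: eq_bigr => j _; apply: eq_bigr => i _; rewrite /G subnKC // -ltnS.
elim: n => [|n IHn]; first by rewrite !big_ord1.
rewrite big_ord_recr /= IHn [RHS]big_ord_recr /= subnn big_ord1.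
rewrite [X in _ + X]big_ord_recr /= subnn addrA; congr (_ + _).
rewrite -big_split; apply: eq_bigr => i _ /=.
by rewrite subSn ?[RHS]big_ord_recr //= -ltnS.
Qed.
End Triangular.

(* k[[t]]: fps_coef f n is the coefficient of t^n. *)
Record fps (k : Type) := FPS { fps_coef : nat -> k }.
Arguments fps_coef {k} _ _.

Section FPS.
Variable k : comNzRingType.

HB.instance Definition _ := gen_eqMixin (fps k).
HB.instance Definition _ := gen_choiceMixin (fps k).

Implicit Types f g h : fps k.

Lemma fpsP f g : fps_coef f =1 fps_coef g -> f = g.
Proof. by case: f g => f [g] /funext /= ->. Qed.

Definition fps_zero : fps k := FPS (fun=> 0).
Definition fps_opp f := FPS (fun n => - fps_coef f n).
Definition fps_add f g := FPS (fun n => fps_coef f n + fps_coef g n).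
Definition fps_one : fps k := FPS (fun n => (n == 0)%:R).
Definition fps_mul f g :=
  FPS (fun n => \sum_(j < n.+1) fps_coef f j * fps_coef g (n - j)%N).

Fact fps_addA : associative fps_add.
Proof. by move=> f g h; apply: fpsP => n /=; rewrite addrA. Qed.
Fact fps_addC : commutative fps_add.
Proof. by move=> f g; apply: fpsP => n /=; rewrite addrC. Qed.
Fact fps_add0 : left_id fps_zero fps_add.
Proof. by move=> f; apply: fpsP => n /=; rewrite add0r. Qed.
Fact fps_addN : left_inverse fps_zero fps_opp fps_add.
Proof. by move=> f; apply: fpsP => n /=; rewrite addNr. Qed.

HB.instance Definition _ :=
  GRing.isZmodule.Build (fps k) fps_addA fps_addC fps_add0 fps_addN.

Fact fps_mulA : associative fps_mul.
Proof.
move=> f g h; apply: fpsP => n /=.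
under [RHS]eq_bigr => j _ do rewrite mulr_suml.
rewrite (sum_triangle n (fun i j =>
  fps_coef f i * fps_coef g (j - i)%N * fps_coef h (n - j)%N)).
apply: eq_bigr => i _; rewrite mulr_sumr; apply: eq_bigr => j _.
by rewrite mulrA addKn subnDA.
Qed.

Fact fps_mulC : commutative fps_mul.
Proof.
move=> f g; apply: fpsP => n /=; rewrite (reindex_inj rev_ord_inj) /=.
by apply: eq_bigr => j _; rewrite subSS subKn -1?ltnS // mulrC.
Qed.

Fact fps_mul1 : left_id fps_one fps_mul.
Proof.
move=> f; apply: fpsP => n /=; rewrite big_ord_recl /= mul1r subn0.
by rewrite big1 ?addr0 // => j _; rewrite mul0r.
Qed.

Fact fps_mulDl : left_distributive fps_mul fps_add.
Proof.
move=> f g h; apply: fpsP => n /=; rewrite -big_split.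
by apply: eq_bigr => j _; rewrite mulrDl.
Qed.

Fact fps_1neq0 : fps_one != 0.
Proof.
by apply/eqP => /(congr1 (fun f => fps_coef f 0)) /eqP; rewrite oner_eq0.
Qed.

HB.instance Definition _ := GRing.Zmodule_isComNzRing.Build (fps k)
  fps_mulA fps_mulC fps_mul1 fps_mulDl fps_1neq0.

End FPS.

(* A finite quiver Q with an ideal I generated by paths of length two.  I is
   given by its generators: (c, b) \in zrel stands for the path cb (first b,
   then c).  Since I is generated in length two, a path lies in I iff two
   consecutive arrows of it form a generator. *)
Record bound_quiver := BoundQuiver {
  vtx : finType;
  arr : finType;
  src : arr -> vtx;
  tgt : arr -> vtx;
  zrel : {set arr * arr};
  zrel_path : forall c b, (c, b) \in zrel -> src c = tgt b
}.
Arguments src {_} _.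
Arguments tgt {_} _.

(* cb is a path not in I; non-composable products are zero. *)
Definition composable (Q : bound_quiver) (c b : arr Q) : bool :=
  (src c == tgt b) && ((c, b) \notin zrel Q).

(* A word lists the arrows of a path from left to right as written, so the last
   one is travelled first; v is the end vertex, needed for trivial paths. *)
Definition word_ok (Q : bound_quiver) (v : vtx Q) (w : seq (arr Q)) : bool :=
  if w is a :: w' then (tgt a == v) && path (@composable Q) a w' else true.

(* The paths of Q (trivial ones included) that are not in I. *)
Record qpath (Q : bound_quiver) := QPath {
  ptgt : vtx Q;
  pword : seq (arr Q);
  _ : word_ok ptgt pword
}.

Section Paths.
Variable Q : bound_quiver.
Implicit Types (p q : qpath Q) (v : vtx Q) (w : seq (arr Q)).

Definition psrc_aux v w := last v (map src w).
Definition psrc p := psrc_aux (ptgt p) (pword p).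
Definition plen p := size (pword p).

Lemma qpathP p q : ptgt p = ptgt q -> pword p = pword q -> p = q.
Proof.
case: p q => v w hw [v' w' hw'] /= ev ew; subst; congr QPath.
exact: bool_irrelevance.
Qed.

Lemma pwordP p : word_ok (ptgt p) (pword p). Proof. by case: p. Qed.

Lemma word_ok_take v w j : word_ok v w -> word_ok v (take j w).
Proof.
case: w j => // a w [|j] //= /andP[-> h] /=.
by move: h; rewrite -{1}(cat_take_drop j w) cat_path => /andP[].
Qed.

Lemma word_ok_drop v w j :
  word_ok v w -> word_ok (psrc_aux v (take j w)) (drop j w).
Proof.
rewrite /psrc_aux.
elim: w v j => // a w IHw v [|j] //= /andP[_ h].
apply: IHw; case: w h => //= b w /andP[/andP[/eqP-> _] ->].
by rewrite eqxx.
Qed.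

(* p = pleft p j * pright p j, with j arrows in the left factor. *)
Definition pleft p j : qpath Q := QPath (word_ok_take j (pwordP p)).
Definition pright p j : qpath Q := QPath (word_ok_drop j (pwordP p)).

Lemma psrc_aux_cat v w1 w2 :
  psrc_aux v (w1 ++ w2) = psrc_aux (psrc_aux v w1) w2.
Proof. by rewrite /psrc_aux map_cat last_cat. Qed.

Lemma plen_left p (j : nat) : (j <= plen p)%N -> plen (pleft p j) = j.
Proof. by move=> h; rewrite /plen /= size_takel. Qed.
Lemma plen_right p j : plen (pright p j) = (plen p - j)%N.
Proof. by rewrite /plen /= size_drop. Qed.

Lemma pleft_left p i j : (i <= j)%N -> pleft (pleft p j) i = pleft p i.
Proof. by move=> h; apply: qpathP => //=; rewrite take_takel. Qed.

Lemma pright_left p i j :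
  pright (pleft p (i + j)) i = pleft (pright p i) j.
Proof.
apply: qpathP => /=; first by rewrite take_takel ?leq_addr.
by rewrite take_drop addnC.
Qed.

Lemma pright_right p i j : pright (pright p i) j = pright p (i + j).
Proof.
apply: qpathP => /=; last by rewrite drop_drop addnC.
by rewrite takeD psrc_aux_cat.
Qed.

Lemma pleft_full p : pleft p (plen p) = p.
Proof. by apply: qpathP; rewrite //= take_size. Qed.

Lemma pright0 p : pright p 0 = p.
Proof. by apply: qpathP; rewrite //= ?drop0 ?take0. Qed.

End Paths.

(* The arrow ideal completion of kQ/I: since I and the powers of the arrow
   ideal m are spanned by paths, kQ/(I + m^n) has as basis the paths of length
   < n outside I, and the inverse limit consists of all formal sums of paths
   outside I, multiplied by concatenation.  The identification with
   lim_n kQ/(I + m^n) is path_image_ker, path_image_limit and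
   path_image_dense below. *)
Record pseries (k : Type) (Q : bound_quiver) := PSeries { pcoef : qpath Q -> k }.
Arguments pcoef {k Q} _ _.

Section PathSeries.
Variables (k : comNzRingType) (Q : bound_quiver).

HB.instance Definition _ := gen_eqMixin (pseries k Q).
HB.instance Definition _ := gen_choiceMixin (pseries k Q).

Implicit Types (f g h : pseries k Q) (p : qpath Q).

Lemma pseriesP f g : pcoef f =1 pcoef g -> f = g.
Proof. by case: f g => f [g] /funext /= ->. Qed.

Definition pseries_zero : pseries k Q := PSeries (fun=> 0).
Definition pseries_opp f := PSeries (fun p => - pcoef f p).
Definition pseries_add f g := PSeries (fun p => pcoef f p + pcoef g p).
Definition pseries_one : pseries k Q := PSeries (fun p => (plen p == 0)%:R).
Definition pseries_mul f g := PSeries (fun p =>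
  \sum_(j < (plen p).+1) pcoef f (pleft p j) * pcoef g (pright p j)).

Fact pseries_addA : associative pseries_add.
Proof. by move=> f g h; apply: pseriesP => n /=; rewrite addrA. Qed.
Fact pseries_addC : commutative pseries_add.
Proof. by move=> f g; apply: pseriesP => n /=; rewrite addrC. Qed.
Fact pseries_add0 : left_id pseries_zero pseries_add.
Proof. by move=> f; apply: pseriesP => n /=; rewrite add0r. Qed.
Fact pseries_addN : left_inverse pseries_zero pseries_opp pseries_add.
Proof. by move=> f; apply: pseriesP => n /=; rewrite addNr. Qed.

HB.instance Definition _ := GRing.isZmodule.Build (pseries k Q)
  pseries_addA pseries_addC pseries_add0 pseries_addN.

Fact pseries_mulA : associative pseries_mul.
Proof.
move=> f g h; apply: pseriesP => p /=.
transitivity (\sum_(j < (plen p).+1) \sum_(i < j.+1)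
   pcoef f (pleft p i) * pcoef g (pright (pleft p j) i) * pcoef h (pright p j));
  last first.
  apply: eq_bigr => j _; rewrite mulr_suml plen_left -1?ltnS //.
  by apply: eq_bigr => i _; rewrite pleft_left // -ltnS.
rewrite (sum_triangle (plen p) (fun i j =>
  pcoef f (pleft p i) * pcoef g (pright (pleft p j) i) * pcoef h (pright p j))).
apply: eq_bigr => i _; rewrite mulr_sumr plen_right; apply: eq_bigr => j _.
by rewrite mulrA pright_left pright_right.
Qed.

Fact pseries_mul1l : left_id pseries_one pseries_mul.
Proof.
move=> f; apply: pseriesP => p /=; rewrite big_ord_recl /= pright0.
rewrite plen_left // mul1r big1 ?addr0 // => j _.
by rewrite plen_left /= ?mul0r.
Qed.

Fact pseries_mul1r : right_id pseries_one pseries_mul.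
Proof.
move=> f; apply: pseriesP => p /=; rewrite big_ord_recr /= pleft_full.
rewrite plen_right subnn mulr1 big1 ?add0r // => j _.
by rewrite plen_right subn_eq0 leqNgt ltn_ord mulr0.
Qed.

Fact pseries_mulDl : left_distributive pseries_mul pseries_add.
Proof.
move=> f g h; apply: pseriesP => p /=; rewrite -big_split.
by apply: eq_bigr => j _; rewrite mulrDl.
Qed.

Fact pseries_mulDr : right_distributive pseries_mul pseries_add.
Proof.
move=> f g h; apply: pseriesP => p /=; rewrite -big_split.
by apply: eq_bigr => j _; rewrite mulrDr.
Qed.

HB.instance Definition _ := GRing.Zmodule_isPzRing.Build (pseries k Q)
  pseries_mulA pseries_mul1l pseries_mul1r pseries_mulDl pseries_mulDr.

Lemma pcoef0 p : pcoef (0 : pseries k Q) p = 0. Proof. by []. Qed.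
Lemma pcoef1 p : pcoef (1 : pseries k Q) p = (plen p == 0)%:R.
Proof. by []. Qed.
Lemma pcoefD f g p : pcoef (f + g) p = pcoef f p + pcoef g p.
Proof. by []. Qed.
Lemma pcoefM f g p : pcoef (f * g) p =
  \sum_(j < (plen p).+1) pcoef f (pleft p j) * pcoef g (pright p j).
Proof. by []. Qed.
Lemma pcoef_sum I (r : seq I) P (F : I -> pseries k Q) p :
  pcoef (\sum_(i <- r | P i) F i) p = \sum_(i <- r | P i) pcoef (F i) p.
Proof. by apply: (big_morph (fun f => pcoef f p)). Qed.

End PathSeries.

(* Generation of I in length two is part of bound_quiver. *)
Record complete_gentle (Q : bound_quiver) : Prop := CompleteGentle {
  two_starting : forall v : vtx Q, #|[set a : arr Q | src a == v]| = 2;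
  two_ending : forall v : vtx Q, #|[set a : arr Q | tgt a == v]| = 2;
  unique_after : forall b : arr Q, exists! c, composable c b;
  unique_before : forall b : arr Q, exists! a, composable b a
}.

(* On a complete gentle quiver this is the unique arrow c with ca not in I
   (lemma sigmaP); elsewhere the value is irrelevant. *)
Definition sigma (Q : bound_quiver) (a : arr Q) : arr Q :=
  odflt a [pick c | composable c a].

(* orbit sigma a = [:: a; sigma a; ...; sigma^(n(a)-1) a] in order of travel,
   hence the reversal. *)
Definition cyc_word (Q : bound_quiver) (a : arr Q) : seq (arr Q) :=
  rev (orbit (@sigma Q) a).

Section Cycles.
Variables (k : comNzRingType) (Q : bound_quiver).

Definition cyc (a : arr Q) : pseries k Q :=
  PSeries (fun p => (pword p == cyc_word a)%:R).
Definition cyc_sum : pseries k Q := \sum_a cyc a.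

(* The map k[[t]] -> Lambda with t |-> cyc_sum, i.e. \sum_n r_n cyc_sum^n; the
   sum converges because cyc_sum^n has no terms of length < n. *)
Definition cyc_eval (r : fps k) : pseries k Q := PSeries (fun p =>
  \sum_(n < (plen p).+1) fps_coef r n * pcoef (cyc_sum ^+ n) p).

Hypothesis gQ : complete_gentle Q.

Lemma sigmaP (c b : arr Q) : composable c b = (c == sigma b).
Proof.
have [d [hd ud]] := unique_after gQ b.
have es : sigma b = d.
  rewrite /sigma; case: pickP => [e /= he|/(_ d)]; last by rewrite hd.
  by rewrite (ud _ he).
by rewrite es; apply/idP/eqP => [/ud ->|->].
Qed.

Lemma sigma_inj : injective (@sigma Q).
Proof.
move=> a b e; have [d [hd ud]] := unique_before gQ (sigma a).
have /ud <- : composable (sigma a) a by rewrite sigmaP.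
by apply: ud; rewrite e sigmaP.
Qed.

Lemma src_sigma (a : arr Q) : src (sigma a) = tgt a.
Proof. by have: composable (sigma a) a by [rewrite sigmaP]; case/andP=> /eqP. Qed.

Lemma rev_word p : p <> [::] -> (exists v : vtx Q, word_ok v p) ->
  exists a : arr Q, rev p = traject (@sigma Q) a (size p).
Proof.
case/lastP: p => // p a _ [v hp]; exists a.
rewrite size_rcons rev_rcons /=; congr (_ :: _).
have /fpathP[n en] : fpath (@sigma Q) a (rev p).
  have: sorted (@composable Q) (rcons p a).
    by case: (p) hp => //= b q /andP[].
  rewrite -[rcons p a]revK rev_sorted rev_rcons /=.
  by apply: sub_path => x y; rewrite sigmaP eq_sym.
by rewrite en; congr traject; rewrite -(size_rev p) en size_traject.
Qed.

Lemma order_iter i (a : arr Q) :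
  order (@sigma Q) (iter i (@sigma Q) a) = order (@sigma Q) a.
Proof.
elim: i => //= i <-; set y := iter i _ a; apply: eq_card => x.
exact: esym (same_fconnect1 sigma_inj y x).
Qed.

Lemma pcoef_cyc_sum (p : qpath Q) a L : rev (pword p) = traject (@sigma Q) a L ->
  pcoef cyc_sum p = (L == order (@sigma Q) a)%:R.
Proof.
move=> ew; rewrite /cyc_sum pcoef_sum /=.
have e b : (pword p == cyc_word b) = ((b == a) && (L == order (@sigma Q) a)).
  rewrite -(inj_eq (can_inj revK)) ew /cyc_word revK /orbit.
  have [->|nL] := eqVneq L (order (@sigma Q) a).
    rewrite andbT; apply/eqP/eqP => [|-> //].
    by rewrite -(orderSpred _ a) -(orderSpred _ b) !trajectS => -[->].
  rewrite andbF; apply/eqP => e; case/eqP: nL.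
  have sL : L = order (@sigma Q) b.
    by have := congr1 size e; rewrite !size_traject.
  have eab : a = b by move: (congr1 (head a) e); rewrite sL -orderSpred.
  by rewrite sL eab.
under eq_bigr => b _ do rewrite e.
rewrite (bigD1 a) //= eqxx big1 ?addr0 // => b /negPf->.
by [].
Qed.

Lemma pcoef_cyc_sum0 (p : qpath Q) : plen p = 0 -> pcoef cyc_sum p = 0.
Proof.
rewrite /plen /cyc_sum pcoef_sum => /size0nil /= ->.
rewrite big1 // => a _; suff -> : ([::] == cyc_word a) = false by [].
by apply/eqP => /(congr1 size); rewrite size_rev size_orbit -orderSpred.
Qed.

Lemma cyc_sumC f : cyc_sum * f = f * cyc_sum.
Proof.
apply: pseriesP => p; rewrite !pcoefM.
have [e0|n0] := eqVneq (plen p) 0.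
  by rewrite e0 !big_ord1 !pcoef_cyc_sum0 ?mulr0 ?mul0r // /plen /= ?size_take
    ?size_drop -?/(plen p) ?e0.
have [a ew] : exists a, rev (pword p) = traject (@sigma Q) a (plen p).
  apply: rev_word; last by exists (ptgt p); apply: pwordP.
  by move=> e; rewrite /plen e in n0.
set L := plen p in ew n0 *; set s := @sigma Q in ew *; set n := order s a.
have eL j : (j <= L)%N -> pcoef cyc_sum (pleft p j) = (j == n)%:R.
  move=> le_jL; rewrite (@pcoef_cyc_sum _ (iter (L - j) s a) j) ?order_iter //=.
  rewrite rev_take -/(plen p) -/L ew -[X in drop _ (traject _ _ X)](subnK le_jL) trajectD drop_size_cat //.
  by rewrite size_traject.
have eR j : (j <= L)%N -> pcoef cyc_sum (pright p j) = ((L - j)%N == n)%:R.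
  move=> le_jL; rewrite (@pcoef_cyc_sum _ a (L - j)) //=.
  by rewrite rev_drop -/(plen p) -/L ew take_traject ?leq_subr.
have [lt_Ln|le_nL] := ltnP L n.
  rewrite !big1 // => j _.
    rewrite eR -1?ltnS // (_ : (L - j)%N == n = false) ?mulr0 //.
    by apply/eqP => e; move: (leq_subr j L); rewrite e leqNgt lt_Ln.
  rewrite eL -1?ltnS // (_ : (j == n :> nat) = false) ?mul0r //.
  by apply/eqP => e; move: lt_Ln; rewrite -e ltnNge -ltnS ltn_ord.
rewrite (bigD1 (Ordinal (le_nL : n < L.+1)%N)) //= eL // eqxx mul1r.
rewrite big1 ?addr0; last first.
  move=> j nj; rewrite eL -1?ltnS // (_ : (j == n :> nat) = false) ?mul0r //.
  exact: negPf nj.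
have lt_m : (L - n < L.+1)%N by rewrite ltnS leq_subr.
rewrite (bigD1 (Ordinal lt_m)) //= eR ?leq_subr // subKn // eqxx mulr1.
rewrite big1 ?addr0; last first.
  move=> j nj; rewrite eR -1?ltnS // (_ : (L - j == n)%N = false) ?mulr0 //.
  apply/negbTE; apply: contra nj => /eqP e.
  by rewrite -val_eqE /= -e subKn // -ltnS.
congr pcoef; apply: qpathP => /=; last first.
  apply: (can_inj revK); rewrite rev_drop rev_take -/(plen p) -/L subKn // ew take_traject ?leq_subr //.
  rewrite -[X in drop _ (traject _ _ X)](subnKC le_nL) trajectD drop_size_cat ?size_traject //.
  by rewrite /n iter_order //; apply: sigma_inj.
have n_gt0 : (0 < n)%N by apply: order_gt0.
have L_gt0 : (0 < L)%N by rewrite lt0n.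
have := pwordP p; rewrite -[pword p]revK ew.
rewrite -[in traject _ _ L](prednK L_gt0) trajectSr rev_rcons.
case/andP=> /eqP<- _.
have -> : take n (iter L.-1 s a :: rev (traject s a L.-1)) =
          rev (traject s (iter (L - n) s a) n).
  rewrite -rev_rcons -trajectSr prednK // take_rev size_traject -[X in drop _ (traject _ _ X)](subnK le_nL) trajectD drop_size_cat //.
  by rewrite size_traject.
have -> z : traject s z n = z :: traject s (s z) n.-1.
  by rewrite -{1}(prednK n_gt0) trajectS.
rewrite rev_cons /psrc_aux map_rcons last_rcons.
rewrite -[RHS]src_sigma -/s -iterS prednK //; congr src.
rewrite -[in RHS](subnK le_nL) iterD /n iter_order //; exact: sigma_inj.
Qed.

Lemma pcoef_cyc_exp n p : (plen p < n)%N -> pcoef (cyc_sum ^+ n) p = 0.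
Proof.
elim: n p => // n IHn p lt_pn; rewrite exprS pcoefM big1 // => -[j lt_j] _ /=.
rewrite ltnS in lt_j; case: j lt_j => [|j] lt_j.
  by rewrite pcoef_cyc_sum0 ?mul0r // plen_left.
rewrite IHn ?mulr0 // plen_right; apply: leq_trans (_ : plen p <= n)%N => //.
by rewrite ltn_subrL /=; apply: leq_trans lt_j.
Qed.


Lemma cyc_eval_widen r p N : (plen p <= N)%N ->
  pcoef (cyc_eval r) p = \sum_(n < N.+1) fps_coef r n * pcoef (cyc_sum ^+ n) p.
Proof.
move=> leN /=; rewrite (big_ord_widen N.+1
  (fun n => fps_coef r n * pcoef (cyc_sum ^+ n) p)) // big_mkcond /=.
apply: eq_bigr => n _; case: ltnP => // lt_pn.
by rewrite pcoef_cyc_exp ?mulr0.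
Qed.

Fact cyc_eval_is_zmod_morphism : zmod_morphism cyc_eval.
Proof.
move=> r s; apply: pseriesP => p.
rewrite (pcoefD (cyc_eval r) (- cyc_eval s)) /= -sumrB.
by apply: eq_bigr => n _; rewrite mulrBl.
Qed.

Fact cyc_eval_is_monoid_morphism : monoid_morphism cyc_eval.
Proof.
split=> [|r s]; apply: pseriesP => p.
  rewrite /= big_ord_recl /= mul1r big1 ?addr0 // => n _.
  by rewrite mul0r.
set L := plen p; rewrite pcoefM [LHS]/= -/L.
transitivity (\sum_(n < L.+1) \sum_(m < L.+1)
    fps_coef r n * fps_coef s m * pcoef (cyc_sum ^+ (n + m)) p); last first.
  under [RHS]eq_bigr => j _.
    rewrite (@cyc_eval_widen r _ L) ?plen_left -1?ltnS //.
    rewrite (@cyc_eval_widen s _ L) ?plen_right ?leq_subr // mulr_suml.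
    under eq_bigr => n _ do rewrite mulr_sumr.
    over.
  rewrite [RHS]exchange_big; apply: eq_bigr => n _.
  rewrite [RHS]exchange_big; apply: eq_bigr => m _ /=.
  rewrite exprD pcoefM mulr_sumr; apply: eq_bigr => j _.
  by rewrite mulrACA.
transitivity (\sum_(n < L.+1) \sum_(m < n.+1)
    fps_coef r m * fps_coef s (n - m)%N * pcoef (cyc_sum ^+ n) p).
  by apply: eq_bigr => n _; rewrite mulr_suml.
rewrite (sum_triangle L (fun m n =>
   fps_coef r m * fps_coef s (n - m)%N * pcoef (cyc_sum ^+ n) p)).
apply: eq_bigr => n _; under eq_bigr => m _ do rewrite addKn.
rewrite (big_ord_widen L.+1 (fun m =>
   fps_coef r n * fps_coef s m * pcoef (cyc_sum ^+ (n + m)) p)) ?ltnS ?leq_subr //.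
rewrite big_mkcond /=; apply: eq_bigr => m _; case: ltnP => // lt_m.
by rewrite pcoef_cyc_exp ?mulr0 // -/L; move: lt_m; rewrite ltn_subLR // -ltnS.
Qed.

Lemma cyc_evalC r f : cyc_eval r * f = f * cyc_eval r.
Proof.
have zC n : cyc_sum ^+ n * f = f * cyc_sum ^+ n.
  elim: n => [|n IHn]; first by rewrite expr0 mul1r mulr1.
  by rewrite exprSr -mulrA cyc_sumC mulrA IHn -mulrA -exprSr.
apply: pseriesP => p; rewrite !pcoefM; set L := plen p.
have -> : \sum_(j < L.+1) pcoef (cyc_eval r) (pleft p j) * pcoef f (pright p j)
   = \sum_(n < L.+1) fps_coef r n * pcoef (cyc_sum ^+ n * f) p.
  under eq_bigr => j _.
    rewrite (@cyc_eval_widen r _ L) ?plen_left -1?ltnS // mulr_suml; over.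
  rewrite exchange_big; apply: eq_bigr => n _; rewrite pcoefM mulr_sumr.
  by apply: eq_bigr => j _; rewrite mulrA.
under [RHS]eq_bigr => j _.
  rewrite (@cyc_eval_widen r _ L) ?plen_right ?leq_subr // mulr_sumr; over.
rewrite exchange_big; apply: eq_bigr => n _; rewrite zC pcoefM mulr_sumr.
by apply: eq_bigr => j _; rewrite mulrCA.
Qed.

HB.instance Definition _ := GRing.isZmodMorphism.Build (fps k) (pseries k Q)
  cyc_eval cyc_eval_is_zmod_morphism.
HB.instance Definition _ := GRing.isMonoidMorphism.Build (fps k) (pseries k Q)
  cyc_eval cyc_eval_is_monoid_morphism.

End Cycles.

(* R-algebras as rings with a central structure map: algType would exclude the
   zero ring, which is the order of the empty quiver. *)
Record ralgebra (R : comPzRingType) := RAlgebra {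
  ralg_ring :> pzRingType;
  ralg_str : {rmorphism R -> ralg_ring};
  ralg_strC : forall r x, ralg_str r * x = x * ralg_str r
}.

Definition ribbon_order (k : fieldType) (Q : bound_quiver)
    (gQ : complete_gentle Q) : ralgebra (fps k) :=
  @RAlgebra (fps k) (pseries k Q) (@cyc_eval k Q) (@cyc_evalC k Q gQ).

Section Ideals.
Variable A : pzRingType.

(* The two-sided ideal generated by S. *)
Definition ideal_gen (S : A -> Prop) (x : A) : Prop :=
  exists (n : nat) (a s b : 'I_n -> A),
    (forall i, S (s i)) /\ x = \sum_i a i * s i * b i.

Fixpoint ideal_pow (J : A -> Prop) (n : nat) : A -> Prop :=
  if n is m.+1 then
    ideal_gen (fun z => exists x y, [/\ J x, ideal_pow J m y & z = x * y])
  else fun=> True.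

Lemma ideal_gen_sub (S : A -> Prop) x : S x -> ideal_gen S x.
Proof.
move=> Sx; exists 1, (fun=> 1), (fun=> x), (fun=> 1); split=> //.
by rewrite big_ord1 mul1r mulr1.
Qed.

Lemma ideal_gen0 (S : A -> Prop) : ideal_gen S 0.
Proof. by exists 0, (fun=> 0), (fun=> 0), (fun=> 0); split=> [[]|]; rewrite ?big_ord0. Qed.

Lemma ideal_genD (S : A -> Prop) x y :
  ideal_gen S x -> ideal_gen S y -> ideal_gen S (x + y).
Proof.
move=> [n [a [s [b [Ss ->]]]]] [n' [a' [s' [b' [Ss' ->]]]]].
pose glue (f : 'I_n -> A) (f' : 'I_n' -> A) (i : 'I_(n + n')) :=
  match split i with inl j => f j | inr j => f' j end.
exists (n + n')%N, (glue a a'), (glue s s'), (glue b b'); split.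
  by move=> i; rewrite /glue; case: split.
have gl f f' j : glue f f' (lshift n' j) = f j.
  by rewrite /glue; case: split_ordP => i /eqP; rewrite ?eq_shift // => /eqP->.
have gr f f' j : glue f f' (rshift n j) = f' j.
  by rewrite /glue; case: split_ordP => i /eqP; rewrite ?eq_shift // => /eqP->.
rewrite big_split_ord; congr (_ + _); apply: eq_bigr => i _.
  by rewrite !gl.
by rewrite !gr.
Qed.

Lemma ideal_gen_mul (S : A -> Prop) u x v :
  ideal_gen S x -> ideal_gen S (u * x * v).
Proof.
move=> [n [a [s [b [Ss ->]]]]].
exists n, (fun i => u * a i), s, (fun i => b i * v); split=> //.
rewrite mulr_sumr mulr_suml; apply: eq_bigr => i _; by rewrite !mulrA.
Qed.

Lemma ideal_pow0 J n : ideal_pow J n 0.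
Proof. by case: n => //= n; apply: ideal_gen0. Qed.
Lemma ideal_powD J n x y :
  ideal_pow J n x -> ideal_pow J n y -> ideal_pow J n (x + y).
Proof. by case: n => //= n; apply: ideal_genD. Qed.
End Ideals.

Fact free_quiver_subproof (Q : bound_quiver) (c b : arr Q) :
  (c, b) \in set0 -> src c = tgt b.
Proof. by rewrite inE. Qed.

Definition free_quiver (Q : bound_quiver) : bound_quiver :=
  BoundQuiver (@free_quiver_subproof Q).

Section PathAlgebra.
Variables (k : fieldType) (Q : bound_quiver).

HB.instance Definition _ := gen_eqMixin (qpath Q).

Definition finite_support : {pred pseries k Q} :=
  fun x => `[< exists N, forall p, (N <= plen p)%N -> pcoef x p = 0 >].

Fact finite_support_subring : subring_closed finite_support.
Proof.
split.
- apply/asboolP; exists 1 => p /=; by case: (plen p).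
- move=> x y /asboolP[M xM] /asboolP[N yN]; apply/asboolP.
  exists (maxn M N) => p; rewrite geq_max => /andP[hM hN].
  by rewrite (pcoefD x (- y)) /= xM // yN // subrr.
- move=> x y /asboolP[M xM] /asboolP[N yN]; apply/asboolP.
  exists (M + N)%N => p hp; rewrite pcoefM big1 // => -[j /= lej] _.
  case: (leqP M j) => [leM|ltM]; first by rewrite xM ?mul0r // plen_left.
  rewrite yN ?mulr0 // plen_right leq_subRL // (leq_trans _ hp) //.
  by rewrite leq_add2r ltnW.
Qed.

(* kQ, as the finitely supported series: the quiver being finite, a support is
   finite iff the lengths of its paths are bounded.  It is used below at
   free_quiver Q, where the paths are all the paths of Q. *)
Record path_algebra := PathAlgebra {
  pa_val :> pseries k Q;
  pa_valP : pa_val \in finite_support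
}.
HB.instance Definition _ := [isSub for pa_val].
HB.instance Definition _ := [Choice of path_algebra by <:].
HB.instance Definition _ := GRing.SubChoice_isSubPzRing.Build
  (pseries k Q) finite_support path_algebra finite_support_subring.

Definition mono (c : k) (p : qpath Q) : pseries k Q :=
  PSeries (fun q => if q == p then c else 0).

Fact mono_fin c p : mono c p \in finite_support.
Proof.
apply/asboolP; exists (plen p).+1 => q; rewrite /mono /=.
by case: eqP => // ->; rewrite ltnn.
Qed.
Definition pa_mono c p : path_algebra := PathAlgebra (mono_fin c p).

Fact arrow_word_ok (a : arr Q) : word_ok (tgt a) [:: a].
Proof. by rewrite /= eqxx. Qed.
Definition arrow_path (a : arr Q) : qpath Q := QPath (arrow_word_ok a).

Definition pa_arrow (a : arr Q) : path_algebra := pa_mono 1 (arrow_path a).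

Definition arrow_ideal : path_algebra -> Prop :=
  ideal_gen (fun x => exists a, x = pa_arrow a).

Lemma pa_inj (x y : path_algebra) : pa_val x = pa_val y -> x = y.
Proof. exact: val_inj. Qed.

Lemma pa_mono_split c d p j : (j <= plen p)%N ->
  pa_mono c (pleft p j) * pa_mono d (pright p j) = pa_mono (c * d) p.
Proof.
move=> lej; apply: pa_inj; apply: pseriesP => q.
rewrite [LHS]pcoefM /=; case: eqP => [->|ne].
  rewrite (bigD1 (Ordinal (lej : j < (plen p).+1)%N)) //= !eqxx.
  rewrite big1 ?addr0 // => i nei; case: eqP => [e|_]; rewrite ?mul0r //.
  case/eqP: nei; apply: val_inj => /=.
  by rewrite -(plen_left lej) -e plen_left // -ltnS.
apply: big1 => i _; case: eqP => [el|_]; rewrite ?mul0r //.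
case: eqP => [er|_]; rewrite ?mulr0 //; case: ne; apply: qpathP.
  by have := congr1 (@ptgt Q) el.
rewrite -(cat_take_drop i (pword q)) -(cat_take_drop j (pword p)).
by congr (_ ++ _); [have := congr1 (@pword Q) el | have := congr1 (@pword Q) er].
Qed.

Lemma pleft1 p : (0 < plen p)%N -> exists a, pleft p 1 = arrow_path a.
Proof.
case: p => v [|a w] //= hw _; exists a; apply: qpathP => /=; last by rewrite take0.
by case/andP: hw => /eqP.
Qed.

Lemma arrow_ideal_pow n c p : (n <= plen p)%N ->
  ideal_pow arrow_ideal n (pa_mono c p).
Proof.
elim: n p => // n IHn p lt_np /=; apply: ideal_gen_sub.
have [|a ea] := @pleft1 p; first exact: leq_trans lt_np.
exists (pa_arrow a), (pa_mono c (pright p 1)); split.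
- by apply: ideal_gen_sub; exists a.
- by apply: IHn; rewrite plen_right leq_subRL // (leq_trans _ lt_np).
- by rewrite /pa_arrow -ea pa_mono_split ?mul1r // (leq_trans _ lt_np).
Qed.

Definition mono_at (x : path_algebra) v w : path_algebra :=
  match @idP (@word_ok Q v w) with
  | ReflectT h => pa_mono (pcoef x (QPath h)) (QPath h)
  | ReflectF _ => 0
  end.

Lemma pa_expand (x : path_algebra) : exists N,
  x = \sum_(m < N) \sum_v \sum_(w : m.-tuple (arr Q)) mono_at x v w.
Proof.
have /asboolP[N xN] := pa_valP x; exists N; apply: pa_inj; apply: pseriesP => q.
have valS I (r : seq I) (F : I -> path_algebra) :
    pcoef (\sum_(i <- r) F i) q = \sum_(i <- r) pcoef (F i) q.
  by apply: (big_morph (fun f : path_algebra => pcoef f q)).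
have ne v w : (v, w) != (ptgt q, pword q) -> pcoef (mono_at x v w) q = 0.
  rewrite /mono_at; case: {-}_ / idP => h //= /eqP n.
  by case: eqP => // e; case: n; rewrite e.
rewrite valS; case: (ltnP (plen q) N) => [ltqN|leNq]; last first.
  rewrite xN // big1 // => m _; rewrite valS big1 // => v _.
  rewrite valS big1 // => w _; apply: ne; apply: contraTneq leNq => -[_ e].
  by rewrite -ltnNge /plen -e size_tuple.
rewrite (bigD1 (Ordinal ltqN)) //= valS (bigD1 (ptgt q)) //= valS.
rewrite (bigD1 (in_tuple (pword q))) //= [X in X + _ + _]addrC -!addrA.
rewrite big1 ?add0r => [|w nw]; last first.
  by apply: ne; apply: contra nw => /eqP[e]; apply/eqP/val_inj.
rewrite big1 ?addr0 => [|v nv]; last first.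
  rewrite valS big1 // => w _; apply: ne.
  by apply: contra nv => /eqP[-> _].
rewrite big1 ?addr0 => [|m nm]; last first.
  rewrite valS big1 // => v _; rewrite valS big1 // => w _; apply: ne.
  by apply: contra nm => /eqP[_ e]; rewrite -val_eqE /= /plen -e size_tuple.
rewrite /mono_at; case: {-}_ / idP => [h|]; last by case: (pwordP q).
have -> : QPath h = q by apply: qpathP.
by rewrite /= eqxx.
Qed.

End PathAlgebra.

Section Completion.
Variables (k : fieldType) (Q : bound_quiver).
Local Notation kQ := (path_algebra k (free_quiver Q)).

(* The ideal I of kQ. *)
Definition relation_ideal : kQ -> Prop :=
  ideal_gen (fun x => exists c b : arr Q, (c, b) \in zrel Q /\
    x = pa_arrow k (c : arr (free_quiver Q)) * pa_arrow k (b : arr (free_quiver Q))).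

Definition relation_arrow_ideal (n : nat) (x : kQ) : Prop :=
  exists y z, [/\ relation_ideal y, ideal_pow (@arrow_ideal k (free_quiver Q)) n z
                & x = y + z].

Lemma free_word_ok (p : qpath Q) :
  @word_ok (free_quiver Q) (ptgt p) (pword p).
Proof.
move: (pwordP p); case: (pword p) => //= a w /andP[-> /=].
by apply: sub_path => x y /andP[h _]; rewrite /composable h inE.
Qed.
Definition free_path (p : qpath Q) : qpath (free_quiver Q) :=
  QPath (free_word_ok p).

Definition path_image (x : kQ) : pseries k Q :=
  PSeries (fun p => pcoef x (free_path p)).

Fact path_image_is_zmod_morphism : zmod_morphism path_image.
Proof. by []. Qed.
Fact path_image_is_monoid_morphism : monoid_morphism path_image.
Proof.
split=> [//|x y]; apply: pseriesP => p; rewrite pcoefM.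
apply: eq_bigr => j _ /=; congr (pcoef x _ * pcoef y _); exact: qpathP.
Qed.
HB.instance Definition _ :=
  GRing.isZmodMorphism.Build kQ (pseries k Q) path_image path_image_is_zmod_morphism.
HB.instance Definition _ :=
  GRing.isMonoidMorphism.Build kQ (pseries k Q) path_image path_image_is_monoid_morphism.

Definition low (n : nat) (f : pseries k Q) :=
  forall p, (plen p < n)%N -> pcoef f p = 0.

Lemma low_sum n m (F : 'I_m -> pseries k Q) :
  (forall i, low n (F i)) -> low n (\sum_i F i).
Proof. by move=> h p lt; rewrite pcoef_sum big1 // => i _; apply: h. Qed.

Lemma lowM m n f g : low m f -> low n g -> low (m + n) (f * g).
Proof.
move=> fm gn p lt; rewrite pcoefM big1 // => -[j /= lej] _.
case: (ltnP j m) => [ltm|lem]; first by rewrite fm ?mul0r // plen_left.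
rewrite gn ?mulr0 // plen_right ltn_subLR //.
by apply: leq_trans lt _; rewrite leq_add2r.
Qed.

Lemma low0 f : low 0 f. Proof. by []. Qed.

Lemma low_gen n (S : kQ -> Prop) x : (forall s, S s -> low n (path_image s)) ->
  ideal_gen S x -> low n (path_image x).
Proof.
move=> Sn [m [a [s [b [Ss ->]]]]]; rewrite rmorph_sum; apply: low_sum => i.
rewrite !rmorphM -[n]addn0 -[n]add0n.
by apply: lowM => //; apply: lowM => //; apply: Sn.
Qed.

Lemma low_pow n x : ideal_pow (@arrow_ideal k (free_quiver Q)) n x ->
  low n (path_image x).
Proof.
elim: n x => // n IHn x /=; apply: low_gen => z [u [v [hu hv ->]]].
rewrite rmorphM -add1n; apply: lowM; last exact: IHn.
apply: low_gen hu => s [a ->] p /=; rewrite ltnS leqn0 => /eqP lp.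
by case: eqP => // e; move: lp; rewrite /plen -[pword p]/(pword (free_path p)) e.
Qed.

Lemma relation_image0 x : relation_ideal x -> path_image x = 0.
Proof.
move=> hx; apply: pseriesP => p.
apply: (@low_gen (plen p).+1 _ x _ hx) => // s [c [b [cb ->]]] q _.
rewrite rmorphM pcoefM big1 // => -[j /= lej] _.
case: eqP => [el|_]; last by rewrite mul0r.
case: eqP => [er|_]; last by rewrite mulr0.
have /= wl := congr1 (@pword _) el; have /= wr := congr1 (@pword _) er.
have := pwordP q; rewrite -(cat_take_drop j (pword q)) wl wr /=.
by rewrite /composable cb andbF andbF.
Qed.

Lemma relation_arrow_idealD n x y :
  relation_arrow_ideal n x -> relation_arrow_ideal n y ->
  relation_arrow_ideal n (x + y).
Proof.
move=> [u [v [hu hv ->]]] [u' [v' [hu' hv' ->]]].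
exists (u + u'), (v + v'); split; last by rewrite addrACA.
  exact: ideal_genD.
exact: ideal_powD.
Qed.

Lemma relation_arrow_ideal0 n : relation_arrow_ideal n 0.
Proof.
exists 0, 0; split; rewrite ?addr0 //; first exact: ideal_gen0.
exact: ideal_pow0.
Qed.

Lemma zero_word (v : vtx Q) (w : seq (arr Q)) :
  @word_ok (free_quiver Q) v w -> ~~ word_ok v w ->
  exists2 j, (j.+1 < size w)%N &
    exists c b : arr Q, (c, b) \in zrel Q /\ take 2 (drop j w) = [:: c; b].
Proof.
elim: w v => // a [|b w] IHw v; first by move=> /= ->.
rewrite /= => /andP[-> /andP[/andP[hab hz] hw]] /=.
rewrite /composable hab /=; case: (boolP ((a, b) \in zrel Q)) => [abz _|_ /= nw].
  by exists 0 => //; exists a, b; rewrite /= take0.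
have [||j lt [c [d [cd e]]]] := IHw (tgt b).
- by rewrite /= eqxx hw.
- by rewrite /= eqxx.
by exists j.+1 => //; exists c, d.
Qed.

Lemma relation_mono c (p : qpath (free_quiver Q)) :
  ~~ @word_ok Q (ptgt p) (pword p) -> relation_ideal (pa_mono c p).
Proof.
move/(zero_word (pwordP p)) => [j ltj [a [b [ab e]]]].
rewrite -[c]mul1r -(@pa_mono_split _ _ 1 c p j) ?(ltnW (ltnW ltj)) //.
set q := pright p j; have lq : (2 <= plen q)%N.
  by rewrite plen_right leq_subRL ?addn2 // (ltnW (ltnW ltj)).
rewrite -[c]mul1r -(@pa_mono_split _ _ 1 c q 2) // mulrA.
apply: ideal_gen_mul; apply: ideal_gen_sub; exists a, b; split=> //.
set r := pleft q 2; have lr : plen r = 2 by rewrite plen_left.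
have er : pword r = [:: a; b] by [].
rewrite -[1]mulr1 -(@pa_mono_split _ _ 1 1 r 1) ?lr //.
have okr : @word_ok (free_quiver Q) (ptgt r) [:: a; b] by rewrite -er pwordP.
case/and3P: okr => /eqP ta /andP[/eqP sa _] _.
congr (pa_mono _ _ * pa_mono _ _); apply: qpathP.
- by rewrite [ptgt (arrow_path _)]/= ta.
- by rewrite /= e.
- by rewrite /= e /psrc_aux /= sa.
- by rewrite /= e.
Qed.

(* kQ -> Lambda induces kQ/(I + m^n) = Lambda/(series without terms of length
   < n) for every n, and Lambda is the limit of these quotients. *)
Theorem path_image_ker (n : nat) (x : kQ) :
  (forall p : qpath Q, (plen p < n)%N -> pcoef (path_image x) p = 0) <->
  relation_arrow_ideal n x.
Proof.
split=> [xn|[y [z [hy hz ->]]] p ltp]; last first.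
  have -> : path_image (y + z) = path_image y + path_image z by exact: rmorphD.
  by rewrite relation_image0 // add0r; exact: low_pow hz p ltp.
have [N ->] := pa_expand x.
have J0 := relation_arrow_ideal0 n; have JD := @relation_arrow_idealD n.
apply: big_ind => // m _; apply: big_ind => // v _; apply: big_ind => // w _.
rewrite /mono_at; case: {-}_ / idP => // h; set p := QPath h.
have [lenp|ltpn] := leqP n (plen p).
  exists 0, (pa_mono (pcoef x p) p); split; rewrite ?add0r //.
    exact: ideal_gen0.
  exact: arrow_ideal_pow.
exists (pa_mono (pcoef x p) p), 0; split; rewrite ?addr0 //; last first.
  exact: ideal_pow0.
case: (boolP (@word_ok Q v w)) => okp; last exact: relation_mono.
have -> : pcoef x p = 0.
  rewrite -(xn (QPath okp)) //=; congr (pcoef _ _); exact: qpathP.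
suff -> : pa_mono (0 : k) p = 0 by apply: ideal_gen0.
by apply: pa_inj; apply: pseriesP => q /=; case: eqP.
Qed.

Theorem path_image_limit (x : nat -> kQ) :
  (forall n, relation_arrow_ideal n (x n.+1 - x n)) ->
  exists! f : pseries k Q, forall n p, (plen p < n)%N ->
    pcoef f p = pcoef (path_image (x n)) p.
Proof.
move=> hx; have st n p : (plen p < n)%N ->
    pcoef (path_image (x n)) p = pcoef (path_image (x (plen p).+1)) p.
  elim: n => // n IHn; rewrite ltnS leq_eqVlt => /orP[/eqP-> //|ltpn].
  rewrite -IHn //; apply/eqP; rewrite -subr_eq0; apply/eqP.
  exact: (path_image_ker n _).2 (hx n) p ltpn.
exists (PSeries (fun p => pcoef (path_image (x (plen p).+1)) p)); split.
  by move=> n p ltp; rewrite [RHS]st.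
by move=> g hg; apply: pseriesP => p; rewrite [RHS](hg (plen p).+1).
Qed.

Theorem path_image_dense (f : pseries k Q) (n : nat) :
  exists x : kQ, forall p, (plen p < n)%N -> pcoef f p = pcoef (path_image x) p.
Proof.
pose g : pseries k (free_quiver Q) := PSeries (fun q : qpath (free_quiver Q) =>
  if (plen q < n)%N then
    match @idP (@word_ok Q (ptgt q) (pword q)) with
    | ReflectT h => pcoef f (QPath h) | ReflectF _ => 0 end
  else 0).
have fg : g \in @finite_support k (free_quiver Q).
  by apply/asboolP; exists n => q; rewrite /= leqNgt => /negPf->.
exists (PathAlgebra fg) => p ltp /=.
rewrite /plen /= -/(plen p) ltp; case: {-}_ / idP => [h|]; last first.
  by case; apply: pwordP.
by congr (pcoef f _); apply: qpathP.
Qed.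

End Completion.

(* Hom types carry an explicit equality relation instead of being quotients. *)
Record category := Category {
  obj :> Type;
  hom : obj -> obj -> Type;
  heq : forall x y, hom x y -> hom x y -> Prop;
  idm : forall x, hom x x;
  hcomp : forall x y z, hom y z -> hom x y -> hom x z;
  heq_refl : forall x y (f : hom x y), heq f f;
  heq_sym : forall x y (f g : hom x y), heq f g -> heq g f;
  heq_trans : forall x y (f g h : hom x y), heq f g -> heq g h -> heq f h;
  hcomp_congr : forall x y z (f f' : hom y z) (g g' : hom x y),
    heq f f' -> heq g g' -> heq (hcomp f g) (hcomp f' g');
  hcompA : forall x y z t (f : hom z t) (g : hom y z) (h : hom x y),
    heq (hcomp f (hcomp g h)) (hcomp (hcomp f g) h);
  hcomp1l : forall x y (f : hom x y), heq (hcomp (idm y) f) f;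
  hcomp1r : forall x y (f : hom x y), heq (hcomp f (idm x)) f
}.
Arguments hom {_} _ _.
Arguments heq {_ _ _} _ _.
Arguments idm {_} _.
Arguments hcomp {_ _ _ _} _ _.

Record functor (C D : category) := Functor {
  fobj :> C -> D;
  fmap : forall x y, hom x y -> hom (fobj x) (fobj y);
  fmap_congr : forall x y (f g : hom x y), heq f g -> heq (fmap f) (fmap g);
  fmap1 : forall x, heq (fmap (idm x)) (idm (fobj x));
  fmapM : forall x y z (f : hom y z) (g : hom x y),
    heq (fmap (hcomp f g)) (hcomp (fmap f) (fmap g))
}.
Arguments fmap {_ _} _ {_ _} _.

Lemma functor_comp_congr C D E (G : functor D E) (F : functor C D) x y
    (f g : @hom C x y) :
  heq f g -> heq (fmap G (fmap F f)) (fmap G (fmap F g)).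
Proof. by move=> e; apply/fmap_congr/fmap_congr. Qed.

Lemma functor_comp1 C D E (G : functor D E) (F : functor C D) (x : C) :
  heq (fmap G (fmap F (idm x))) (idm (G (F x))).
Proof. exact: (heq_trans (fmap_congr G (fmap1 F x)) (fmap1 G (F x))). Qed.

Lemma functor_compM C D E (G : functor D E) (F : functor C D) (x y z : C)
    (f : hom y z) (g : hom x y) :
  heq (fmap G (fmap F (hcomp f g)))
      (hcomp (fmap G (fmap F f)) (fmap G (fmap F g))).
Proof. exact: (heq_trans (fmap_congr G (fmapM F f g)) (fmapM G _ _)). Qed.

Definition functor_comp C D E (G : functor D E) (F : functor C D) :
    functor C E :=
  @Functor C E (fun x => G (F x)) (fun x y f => fmap G (fmap F f))
    (functor_comp_congr G F) (functor_comp1 G F) (functor_compM G F).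

Record nat_trans C D (F G : functor C D) := NatTrans {
  nt :> forall x : C, hom (F x) (G x);
  nt_nat : forall (x y : C) (f : hom x y),
    heq (hcomp (nt y) (fmap F f)) (hcomp (fmap G f) (nt x))
}.

Definition is_iso (C : category) (x y : C) (f : hom x y) : Prop :=
  exists g : hom y x, heq (hcomp f g) (idm y) /\ heq (hcomp g f) (idm x).

Definition functor_iso C D (F G : functor C D) : Prop :=
  exists a : nat_trans F G, forall x, is_iso (a x).

(* The Gabriel-Zisman localization C[W^-1]: same objects as C, and morphisms are
   formal composites of morphisms of C and of inverses of elements of W, modulo
   the congruence generated by functoriality and the inversion relations. *)
Section Localization.
Variables (C : category) (W : forall x y : C, hom x y -> Prop).

Inductive zigzag : C -> C -> Type :=
| ZId x : zigzag x x
| ZFwd x y (f : hom x y) : zigzag x y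
| ZInv x y (w : hom x y) (hw : W w) : zigzag y x
| ZComp x y z (u : zigzag y z) (v : zigzag x y) : zigzag x z.

Inductive zeq : forall x y, zigzag x y -> zigzag x y -> Prop :=
| zeq_refl x y (u : zigzag x y) : zeq u u
| zeq_sym x y (u v : zigzag x y) : zeq u v -> zeq v u
| zeq_trans x y (u v w : zigzag x y) : zeq u v -> zeq v w -> zeq u w
| zeq_congr x y z (u u' : zigzag y z) (v v' : zigzag x y) :
    zeq u u' -> zeq v v' -> zeq (ZComp u v) (ZComp u' v')
| zeq_compA x y z t (u : zigzag z t) (v : zigzag y z) (w : zigzag x y) :
    zeq (ZComp u (ZComp v w)) (ZComp (ZComp u v) w)
| zeq_comp1l x y (u : zigzag x y) : zeq (ZComp (ZId y) u) u
| zeq_comp1r x y (u : zigzag x y) : zeq (ZComp u (ZId x)) u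
| zeq_fwd x y (f g : hom x y) : heq f g -> zeq (ZFwd f) (ZFwd g)
| zeq_fwd1 x : zeq (ZFwd (idm x)) (ZId x)
| zeq_fwdM x y z (f : hom y z) (g : hom x y) :
    zeq (ZFwd (hcomp f g)) (ZComp (ZFwd f) (ZFwd g))
| zeq_invl x y (w : hom x y) (hw : W w) :
    zeq (ZComp (ZInv hw) (ZFwd w)) (ZId x)
| zeq_invr x y (w : hom x y) (hw : W w) :
    zeq (ZComp (ZFwd w) (ZInv hw)) (ZId y).

Definition localization : category :=
  @Category C zigzag zeq ZId ZComp zeq_refl zeq_sym zeq_trans zeq_congr
    zeq_compA zeq_comp1l zeq_comp1r.

Definition loc_functor : functor C localization :=
  @Functor C localization id ZFwd zeq_fwd zeq_fwd1 zeq_fwdM.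

End Localization.

Section LocalizedFunctor.
Variables (C C' : category).
Variables (W : forall x y : C, hom x y -> Prop).
Variables (W' : forall x y : C', hom x y -> Prop).
Variables (F : functor C C').
Hypothesis FW : forall x y (w : hom x y), W w -> W' (fmap F w).

Fixpoint zmap x y (u : zigzag W x y) : zigzag W' (F x) (F y) :=
  match u with
  | ZId x => ZId W' (F x)
  | ZFwd x y f => ZFwd W' (fmap F f)
  | ZInv x y w hw => ZInv (FW hw)
  | ZComp x y z u v => ZComp (zmap u) (zmap v)
  end.

Lemma zmap_congr x y (u v : zigzag W x y) :
  zeq u v -> zeq (zmap u) (zmap v).
Proof.
elim=> {x y u v} /=.
- by move=> *; apply: zeq_refl.
- by move=> x y u v _; apply: zeq_sym.
- by move=> x y u v w _ h1 _ h2; apply: zeq_trans h1 h2.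
- by move=> x y z u u' v v' _ h1 _ h2; apply: zeq_congr.
- by move=> *; apply: zeq_compA.
- by move=> *; apply: zeq_comp1l.
- by move=> *; apply: zeq_comp1r.
- by move=> x y f g e; apply/zeq_fwd/fmap_congr.
- by move=> x; apply: zeq_trans (zeq_fwd1 _ _); apply/zeq_fwd/fmap1.
- by move=> x y z f g; apply: zeq_trans (zeq_fwdM _ _ _); apply/zeq_fwd/fmapM.
- by move=> *; apply: zeq_invl.
- by move=> *; apply: zeq_invr.
Qed.

Definition localized : functor (localization W) (localization W') :=
  @Functor (localization W) (localization W') F zmap zmap_congr
    (fun x => zeq_refl _) (fun x y z f g => zeq_refl _).

End LocalizedFunctor.

(* (LF, eta) is the total left derived functor of F: the terminal functor G
   between the localizations with a transformation G o Q -> Q' o F. *)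
Definition is_left_derived (C C' : category)
    (W : forall x y : C, hom x y -> Prop)
    (W' : forall x y : C', hom x y -> Prop) (F : functor C C')
    (LF : functor (localization W) (localization W'))
    (eta : nat_trans (functor_comp LF (loc_functor W))
                     (functor_comp (loc_functor W') F)) : Prop :=
  forall (G : functor (localization W) (localization W'))
         (gam : nat_trans (functor_comp G (loc_functor W))
                          (functor_comp (loc_functor W') F)),
  (exists a : nat_trans G LF, forall x : C, heq (hcomp (eta x) (a x)) (gam x)) /\
  (forall a b : nat_trans G LF,
     (forall x : C, heq (hcomp (eta x) (a x)) (gam x)) ->
     (forall x : C, heq (hcomp (eta x) (b x)) (gam x)) ->
     forall x : C, heq (a x) (b x)).

Section Modules.
Variable A : pzRingType.

Record fgmod := FgMod {
  fg_mod :> lmodType A;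
  fg_gen : exists (n : nat) (g : 'I_n -> fg_mod),
    forall m : fg_mod, exists c : 'I_n -> A, m = \sum_i c i *: g i
}.

Lemma comp_linear (M N P : lmodType A)
  (f : {linear N -> P}) (g : {linear M -> N}) : linear (f \o g).
Proof. by move=> a x y /=; rewrite !linearP. Qed.

Definition modcat : category.
refine (@Category fgmod (fun M N => {linear M -> N})
  (fun M N f g => forall x, f x = g x) (fun M => idfun)
  (fun M N P f g => f \o g) _ _ _ _ _ _ _) => //=.
- by move=> M N f g h e e' x; rewrite e.
- by move=> M N P f f' g g' e e' x /=; rewrite e e'.
Defined.

(* Right-bounded cochain complexes of finitely generated left modules.  Only the
   components cx_d i (i+1) of the differential can be nonzero; the two-index
   form avoids transports along equalities of degrees. *)
Record complex := Complex {
  cx_obj :> int -> fgmod;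
  cx_d : forall i j : int, {linear cx_obj i -> cx_obj j};
  cx_shape : forall i j, j != i + 1 -> forall x, cx_d i j x = 0;
  cx_dd : forall i j l x, cx_d j l (cx_d i j x) = 0;
  cx_bnd : exists N : int, forall i, (N < i)%R -> forall x : cx_obj i, x = 0
}.

Record cmap (X Y : complex) := CMap {
  cm :> forall i : int, {linear X i -> Y i};
  cm_d : forall i j x, cm j (cx_d X i j x) = cx_d Y i j (cm i x)
}.

Definition cmap_id (X : complex) : cmap X X :=
  @CMap X X (fun i => idfun) (fun i j x => erefl).

Lemma cmap_comp_subproof (X Y Z : complex) (f : cmap Y Z) (g : cmap X Y) i j x :
  (f j \o g j) (cx_d X i j x) = cx_d Z i j ((f i \o g i) x).
Proof. by rewrite /= !cm_d. Qed.

Definition cmap_comp (X Y Z : complex) (f : cmap Y Z) (g : cmap X Y) : cmap X Z :=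
  @CMap X Z (fun i => f i \o g i) (cmap_comp_subproof f g).

Definition cxcat : category.
refine (@Category complex cmap (fun X Y f g => forall i x, f i x = g i x)
  cmap_id cmap_comp _ _ _ _ _ _ _) => //=.
- by move=> X Y f g h e e' i x; rewrite e.
- by move=> X Y Z f f' g g' e e' i x /=; rewrite e e'.
Defined.

(* For all i, the map H^i(X) -> H^i(Y) is injective and surjective, spelled out
   on cocycles and coboundaries. *)
Definition quasi_iso (X Y : cxcat) (f : hom X Y) : Prop :=
  forall h i j : int, i = h + 1 -> j = i + 1 ->
  (forall x : cx_obj X i, cx_d X i j x = 0 ->
     (exists y, f i x = cx_d Y h i y) -> exists x', x = cx_d X h i x') /\
  (forall y : cx_obj Y i, cx_d Y i j y = 0 ->
     exists2 x, cx_d X i j x = 0 & exists y', f i x = y + cx_d Y h i y').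

(* Inverting the quasi-isomorphisms among complexes also identifies homotopic
   maps, so this is the localization of K^-(mod A) as well. *)
Definition Dminus : category := localization quasi_iso.

End Modules.

Section Shift.
Variables (A : pzRingType) (n : int).

Section ShiftComplex.
Variable X : complex A.

(* X[n]^i = X^(i+n) with differential (-1)^n d. *)
Definition shift_d (i j : int) (x : X (i + n)) : X (j + n) :=
  (-1) ^+ `|n|%N *: cx_d X (i + n) (j + n) x.

Fact shift_d_linear i j : linear (@shift_d i j).
Proof.
move=> a x y; rewrite /shift_d linearP scalerDr !scalerA.
by congr (_ *: _ + _); rewrite -commr_sign.
Qed.
HB.instance Definition _ i j :=
  GRing.isLinear.Build A (X (i + n)) (X (j + n)) *:%R (@shift_d i j)
    (@shift_d_linear i j).

Fact shift_shape i j : j != i + 1 -> forall x, @shift_d i j x = 0.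
Proof.
move=> ne x; rewrite /shift_d cx_shape ?scaler0 //.
by rewrite addrAC (inj_eq (addIr n)).
Qed.

Fact shift_dd i j l x : @shift_d j l (@shift_d i j x) = 0.
Proof. by rewrite /shift_d linearZ /= cx_dd !scaler0. Qed.

Fact shift_bnd : exists N : int, forall i, N < i -> forall x : X (i + n), x = 0.
Proof.
by have [N hN] := cx_bnd X; exists (N - n) => i; rewrite ltrBlDr => /hN.
Qed.

Definition shift_complex : complex A :=
  @Complex A (fun i => X (i + n)) (fun i j => @shift_d i j)
    shift_shape shift_dd shift_bnd.
End ShiftComplex.

Lemma shift_cmap_subproof (X Y : complex A) (f : cmap X Y) i j
    (x : X (i + n)) :
  f (j + n) (shift_d j x) = shift_d j (f (i + n) x).
Proof. by rewrite /shift_d linearZ cm_d. Qed.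

Definition shift_cmap (X Y : complex A) (f : cmap X Y) :
    cmap (shift_complex X) (shift_complex Y) :=
  @CMap A (shift_complex X) (shift_complex Y) (fun i => f (i + n))
    (@shift_cmap_subproof X Y f).

Definition shift_cx : functor (cxcat A) (cxcat A) :=
  @Functor (cxcat A) (cxcat A) shift_complex shift_cmap
    (fun X Y f g e i => e (i + n))
    (fun X i x => erefl) (fun X Y Z f g i x => erefl).

Lemma shift_quasi_iso (X Y : cxcat A) (f : hom X Y) :
  quasi_iso f -> quasi_iso (fmap shift_cx f).
Proof.
have sg (M : lmodType A) (x y : M) :
    (-1) ^+ `|n|%N *: x = y -> x = (-1) ^+ `|n|%N *: y.
  by move=> <-; rewrite scalerA -signr_odd -expr2 sqrr_sign scale1r.
move=> qf h i j ei ej; have [||qi qs] := qf (h + n) (i + n) (j + n).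
- by rewrite ei addrAC.
- by rewrite ej addrAC.
split=> [x /sg|y /sg]; rewrite /= scaler0.
  move=> dx [y ey]; have [|x' ex'] := qi _ dx.
    by exists ((-1) ^+ `|n|%N *: y); rewrite linearZ.
  exists ((-1) ^+ `|n|%N *: x'); rewrite /= /shift_d linearZ scalerA.
  by rewrite -signr_odd -expr2 sqrr_sign scale1r.
move=> dy; have [x dx [y' ey']] := qs _ dy.
exists x; first by rewrite /= /shift_d dx scaler0.
exists ((-1) ^+ `|n|%N *: y'); rewrite /= /shift_d linearZ scalerA ey'.
by rewrite -signr_odd -expr2 sqrr_sign scale1r.
Qed.

Definition shift : functor (Dminus A) (Dminus A) := localized shift_quasi_iso.

End Shift.

Definition modmap (A : pzRingType) (T : functor (modcat A) (modcat A))
    (M N : fgmod A) (f : {linear M -> N}) :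
    {linear (T M : fgmod A) -> (T N : fgmod A)} :=
  fmap T (f : @hom (modcat A) M N).

Section MapComplex.
Variables (A : pzRingType) (T : functor (modcat A) (modcat A)).
Hypothesis T0 : forall (M N : fgmod A) (f : {linear M -> N}),
  (forall x, f x = 0) -> forall x, modmap T f x = 0.

Section Object.
Variable X : complex A.

Definition map_d (i j : int) : {linear T (X i) -> T (X j)} :=
  modmap T (cx_d X i j).

Fact map_shape i j : j != i + 1 -> forall x, map_d i j x = 0.
Proof. by move=> ne; apply: T0 => x; apply: cx_shape. Qed.

Fact map_dd i j l x : map_d j l (map_d i j x) = 0.
Proof.
rewrite -[LHS](fmapM T (cx_d X j l : @hom (modcat A) _ _)
                       (cx_d X i j : @hom (modcat A) _ _)).
by apply: T0 => y; apply: cx_dd.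
Qed.

Fact map_bnd :
  exists N : int, forall i, N < i -> forall x : (T (X i) : fgmod A), x = 0.
Proof.
have [N hN] := cx_bnd X; exists N => i /hN h x.
rewrite -[LHS](fmap1 T (X i) x); apply: T0 => y; exact: h.
Qed.

Definition map_complex : complex A :=
  @Complex A (fun i => T (X i)) map_d map_shape map_dd map_bnd.
End Object.

Lemma map_cmap_subproof (X Y : complex A) (f : cmap X Y) i j
    (x : (T (X i) : fgmod A)) :
  modmap T (f j) (map_d X i j x) = map_d Y i j (modmap T (f i) x).
Proof.
rewrite -[LHS](fmapM T (f j : @hom (modcat A) _ _)
                       (cx_d X i j : @hom (modcat A) _ _)).
rewrite -[RHS](fmapM T (cx_d Y i j : @hom (modcat A) _ _)
                       (f i : @hom (modcat A) _ _)).
have e : @heq (modcat A) _ _ (f j \o cx_d X i j) (cx_d Y i j \o f i).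
  by move=> y /=; apply: cm_d.
exact: (fmap_congr T e x).
Qed.

Definition map_cmap (X Y : complex A) (f : cmap X Y) :
    cmap (map_complex X) (map_complex Y) :=
  @CMap A (map_complex X) (map_complex Y)
    (fun i => modmap T (f i)) (@map_cmap_subproof X Y f).

Definition map_cx : functor (cxcat A) (cxcat A).
refine (@Functor (cxcat A) (cxcat A) map_complex map_cmap _ _ _).
- by move=> X Y f g e i; apply: (fmap_congr T); apply: e.
- by move=> X i; apply: (fmap1 T).
- by move=> X Y Z f g i; apply: (fmapM T).
Defined.

End MapComplex.

Section Tensor.
Variable A : pzRingType.

Record bimodule := Bimodule {
  bm_mod :> lmodType A;
  bm_ract : bm_mod -> A -> bm_mod;
  bm_ractDl : forall b b' a, bm_ract (b + b') a = bm_ract b a + bm_ract b' a;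
  bm_ractDr : forall b a a', bm_ract b (a + a') = bm_ract b a + bm_ract b a';
  bm_ractM : forall b a a', bm_ract b (a * a') = bm_ract (bm_ract b a) a';
  bm_ract1 : forall b, bm_ract b 1 = b;
  bm_ractZ : forall a b a', bm_ract (a *: b) a' = a *: bm_ract b a'
}.

Definition balanced (B : bimodule) (M : lmodType A) (G : zmodType)
    (beta : B -> M -> G) : Prop :=
  [/\ forall b b' m, beta (b + b') m = beta b m + beta b' m,
      forall b m m', beta b (m + m') = beta b m + beta b m'
    & forall b a m, beta (bm_ract b a) m = beta b (a *: m)].

(* A functor M |-> B \otimes_A M on finitely generated left A-modules: for every
   M the universal balanced map B x M -> T M into abelian groups, with the left
   A-action coming from B, and naturality in M. *)
Record tensor_functor (B : bimodule) := TensorFunctor {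
  tf_fun :> functor (modcat A) (modcat A);
  tf_tens : forall M : fgmod A, B -> M -> (tf_fun M : fgmod A);
  tf_balanced : forall M : fgmod A, balanced (@tf_tens M);
  tf_univ : forall (M : fgmod A) (G : zmodType) (beta : B -> M -> G),
    balanced beta ->
    exists2 u : {additive (tf_fun M : fgmod A) -> G},
      forall b m, u (tf_tens b m) = beta b m
    & forall u' : {additive (tf_fun M : fgmod A) -> G},
        (forall b m, u' (tf_tens b m) = beta b m) -> u' =1 u;
  tf_scale : forall (M : fgmod A) a b (m : M), tf_tens (a *: b) m = a *: tf_tens b m;
  tf_map : forall (M N : fgmod A) (f : {linear M -> N}) b (m : M),
    modmap tf_fun f (tf_tens b m) = tf_tens b (f m)
}.

Lemma tf_zero (B : bimodule) (T : tensor_functor B) (M N : fgmod A)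
    (f : {linear M -> N}) :
  (forall x, f x = 0) ->
  forall x, modmap T f x = 0.
Proof.
move=> f0; set g := modmap T f.
have bal0 : @balanced B M (T N : fgmod A) (fun _ _ => 0).
  by split=> *; rewrite ?addr0.
have [u _ uu] := tf_univ T bal0; move=> x.
have -> : g x = u x.
  apply: (uu g) => b m; rewrite [LHS](tf_map T f b m) f0.
  have [_ D _] := tf_balanced T N.
  by apply: (addIr (tf_tens T b 0)); rewrite -D !add0r.
have h (b : B) (m : M) : (\0 : {additive (T M : fgmod A) -> (T N : fgmod A)})
  (tf_tens T b m) = 0 by [].
by rewrite -(uu _ h).
Qed.

Definition tensor_cx (B : bimodule) (T : tensor_functor B) :
    functor (cxcat A) (cxcat A) := map_cx (@tf_zero B T).

End Tensor.

Section Algebra.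
Variables (R : comPzRingType) (L : ralgebra R).

(* An R-algebra endomorphism e with e o e = id is an automorphism. *)
Record involution := Involution {
  inv_map :> {rmorphism L -> L};
  inv_str : forall r, inv_map (ralg_str L r) = ralg_str L r;
  inv_involutive : involutive inv_map
}.

(* Hom_R(L, R), with (a f b)(x) = f(b x a). *)
Record dual := Dual {
  dual_fun :> L -> R;
  dual_add : {morph dual_fun : x y / x + y};
  dual_lin : forall r x, dual_fun (ralg_str L r * x) = r * dual_fun x
}.

HB.instance Definition _ := gen_eqMixin dual.
HB.instance Definition _ := gen_choiceMixin dual.

Lemma dualP (f g : dual) : f =1 g -> f = g.
Proof.
case: f g => f fD fZ [g gD gZ] /= /funext e; subst g.
by congr Dual; apply: Prop_irrelevance.
Qed.

Implicit Types f g : dual.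

Fact dual_zero_add : {morph (fun=> 0 : R) : x y / x + y :> L >-> x + y}.
Proof. by move=> x y; rewrite addr0. Qed.
Definition dual_zero : dual :=
  Dual dual_zero_add (fun r x => esym (mulr0 r)).

Fact dual_opp_add f : {morph (fun x => - f x) : x y / x + y}.
Proof. by move=> x y; rewrite dual_add opprD. Qed.
Fact dual_opp_lin f r x : - f (ralg_str L r * x) = r * - f x.
Proof. by rewrite dual_lin mulrN. Qed.
Definition dual_opp f : dual := Dual (dual_opp_add f) (dual_opp_lin f).

Fact dual_plus_add f g : {morph (fun x => f x + g x) : x y / x + y}.
Proof. by move=> x y; rewrite !dual_add addrACA. Qed.
Fact dual_plus_lin f g r x :
  f (ralg_str L r * x) + g (ralg_str L r * x) = r * (f x + g x).
Proof. by rewrite !dual_lin mulrDr. Qed.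
Definition dual_plus f g : dual := Dual (dual_plus_add f g) (dual_plus_lin f g).

Fact dual_addA : associative dual_plus.
Proof. by move=> f g h; apply: dualP => x /=; rewrite addrA. Qed.
Fact dual_addC : commutative dual_plus.
Proof. by move=> f g; apply: dualP => x /=; rewrite addrC. Qed.
Fact dual_add0 : left_id dual_zero dual_plus.
Proof. by move=> f; apply: dualP => x /=; rewrite add0r. Qed.
Fact dual_addN : left_inverse dual_zero dual_opp dual_plus.
Proof. by move=> f; apply: dualP => x /=; rewrite addNr. Qed.

HB.instance Definition _ :=
  GRing.isZmodule.Build dual dual_addA dual_addC dual_add0 dual_addN.

Fact dual_scale_add a f : {morph (fun x => f (x * a)) : x y / x + y}.
Proof. by move=> x y; rewrite mulrDl dual_add. Qed.
Fact dual_scale_lin a f r x : f (ralg_str L r * x * a) = r * f (x * a).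
Proof. by rewrite -mulrA dual_lin. Qed.
Definition dual_scale (a : L) f : dual :=
  Dual (dual_scale_add a f) (dual_scale_lin a f).

Fact dual_scaleA a b f : dual_scale a (dual_scale b f) = dual_scale (a * b) f.
Proof. by apply: dualP => x /=; rewrite mulrA. Qed.
Fact dual_scale1 : left_id 1 dual_scale.
Proof. by move=> f; apply: dualP => x /=; rewrite mulr1. Qed.
Fact dual_scaleDr : right_distributive dual_scale +%R.
Proof. by move=> a f g; apply: dualP. Qed.
Fact dual_scaleDl f : {morph dual_scale^~ f : a b / a + b}.
Proof. by move=> a b; apply: dualP => x /=; rewrite mulrDr dual_add. Qed.

HB.instance Definition _ := GRing.Zmodule_isLmodule.Build L dual
  dual_scaleA dual_scale1 dual_scaleDr dual_scaleDl.

Fact dual_ract_add f a : {morph (fun x => f (a * x)) : x y / x + y}.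
Proof. by move=> x y; rewrite mulrDr dual_add. Qed.
Fact dual_ract_lin f a r x : f (a * (ralg_str L r * x)) = r * f (a * x).
Proof. by rewrite mulrA -ralg_strC -mulrA dual_lin. Qed.
Definition dual_ract f (a : L) : dual :=
  Dual (dual_ract_add f a) (dual_ract_lin f a).

Definition canonical_bimodule : bimodule L.
refine (@Bimodule L dual dual_ract _ _ _ _ _).
- by move=> f g a; apply: dualP.
- by move=> f a b; apply: dualP => x; rewrite /= mulrDl dual_add.
- by move=> f a b; apply: dualP => x; rewrite /= mulrA.
- by move=> f; apply: dualP => x; rewrite /= mul1r.
- by move=> a f b; apply: dualP => x; rewrite /= mulrA.
Defined.

End Algebra.

Section Twist.
Variables (R : comPzRingType) (L : ralgebra R).

(* M_e is M with a acting as e(a), i.e. as e^-1(a): in L_e \otimes M one has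
   a \otimes m = 1 \otimes e^-1(a) m. *)
Definition twisted (e : involution L) (M : lmodType L) : Type := M.

Variable e : involution L.

(* L_e: regular left action, right action a * b = a e(b). *)
Definition twisted_bimodule : bimodule L.
refine (@Bimodule L L^o (fun a b => a * e b) _ _ _ _ _).
- by move=> a b c; rewrite mulrDl.
- by move=> a b c; rewrite rmorphD mulrDr.
- by move=> a b c; rewrite rmorphM mulrA.
- by move=> a; rewrite rmorph1 mulr1.
- by move=> a b c; apply: esym (mulrA _ _ _).
Defined.

Section TwistedModule.
Variable M : lmodType L.
HB.instance Definition _ := GRing.Zmodule.on (twisted e M).

Definition twisted_scale (a : L) (m : twisted e M) : twisted e M := e a *: (m : M).

Fact twisted_scaleA a b m :
  twisted_scale a (twisted_scale b m) = twisted_scale (a * b) m.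
Proof. by rewrite /twisted_scale scalerA rmorphM. Qed.
Fact twisted_scale1 : left_id 1 twisted_scale.
Proof. by move=> m; rewrite /twisted_scale rmorph1 scale1r. Qed.
Fact twisted_scaleDr : right_distributive twisted_scale +%R.
Proof. by move=> a m m'; apply: scalerDr. Qed.
Fact twisted_scaleDl m : {morph twisted_scale^~ m : a b / a + b}.
Proof. by move=> a b; rewrite /twisted_scale rmorphD scalerDl. Qed.

HB.instance Definition _ := GRing.Zmodule_isLmodule.Build L (twisted e M)
  twisted_scaleA twisted_scale1 twisted_scaleDr twisted_scaleDl.
End TwistedModule.

Fact twisted_gen (M : fgmod L) :
  exists (n : nat) (g : 'I_n -> twisted e M),
    forall m : twisted e M, exists c : 'I_n -> L, m = \sum_i c i *: g i.
Proof.
have [n [g hg]] := fg_gen M; exists n, g => m; have [c ->] := hg m.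
exists (fun i => e (c i)); apply: eq_bigr => i _.
by rewrite /GRing.scale /= /twisted_scale inv_involutive.
Qed.

Definition twist_fgmod (M : fgmod L) : fgmod L := FgMod (twisted_gen M).

Section TwistLinear.
Variables (M N : fgmod L) (f : {linear M -> N}).
Definition twist_lin_fun (m : twisted e M) : twisted e N := f m.
Fact twist_lin_linear : linear twist_lin_fun.
Proof. by move=> a x y; apply: linearP. Qed.
HB.instance Definition _ :=
  GRing.isLinear.Build L (twisted e M) (twisted e N) *:%R twist_lin_fun
    twist_lin_linear.
Definition twist_lin : {linear twist_fgmod M -> twist_fgmod N} := twist_lin_fun.
End TwistLinear.

Definition twist_mod : functor (modcat L) (modcat L) :=
  @Functor (modcat L) (modcat L) twist_fgmod twist_lin
    (fun M N f g eq x => eq x) (fun M x => erefl) (fun M N P f g x => erefl).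

Definition twist_cx : functor (cxcat L) (cxcat L) :=
  @map_cx L twist_mod (fun M N f f0 x => f0 x).

Fact twist_quasi_iso (X Y : cxcat L) (f : hom X Y) :
  quasi_iso f -> quasi_iso (fmap twist_cx f).
Proof. by []. Qed.

Definition twist : functor (Dminus L) (Dminus L) := localized twist_quasi_iso.

End Twist.

(* Restriction of scalars along e is the tensor functor of L_e, via
   b \otimes m |-> e(b) m; in particular L_e \otimes - is exact and acts
   termwise on complexes. *)
Section TwistTensor.
Variables (R : comPzRingType) (L : ralgebra R) (e : involution L).
Local Notation B := (twisted_bimodule e).

Definition twist_tens (M : fgmod L) (b : B) (m : M) : twisted e M :=
  e (b : L) *: m.

Fact twist_tens_balanced (M : fgmod L) : balanced (@twist_tens M).
Proof.
split=> [b b' m|b m m'|b a m]; rewrite /twist_tens.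
- by rewrite rmorphD scalerDl.
- exact: scalerDr.
- by rewrite rmorphM inv_involutive scalerA.
Qed.

Fact twist_tens_univ (M : fgmod L) (G : zmodType) (beta : B -> M -> G) :
  balanced beta ->
  exists2 u : {additive twist_fgmod e M -> G},
    forall b m, u (twist_tens b m) = beta b m
  & forall u' : {additive twist_fgmod e M -> G},
      (forall b m, u' (twist_tens b m) = beta b m) -> u' =1 u.
Proof.
move=> [bDl bDr bA].
have b0 : beta 1 0 = 0 by apply: (addIr (beta 1 0)); rewrite -bDr !add0r.
have bB : zmod_morphism (beta 1 : twist_fgmod e M -> G).
  move=> x y; apply/eqP; rewrite -subr_eq opprK; apply/eqP.
  by rewrite -bDr subrK.
pose U := GRing.isZmodMorphism.Build _ _ (beta 1 : twist_fgmod e M -> G) bB.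
pose u : {additive twist_fgmod e M -> G} :=
  HB.pack (beta 1 : twist_fgmod e M -> G) U.
exists u => [b m|u' hu' m].
  rewrite /= /twist_tens -bA /=; congr (beta _ m).
  by rewrite inv_involutive mul1r.
by rewrite /= -hu' /twist_tens rmorph1 scale1r.
Qed.

Fact twist_tens_scale (M : fgmod L) a b (m : M) :
  twist_tens (a *: b) m = a *: twist_tens b m.
Proof.
rewrite /twist_tens [RHS]/GRing.scale /= /twisted_scale scalerA.
by rewrite -rmorphM.
Qed.

Fact twist_tens_map (M N : fgmod L) (f : {linear M -> N}) b (m : M) :
  modmap (twist_mod e) f (twist_tens b m) = twist_tens b (f m).
Proof. by apply: linearZ. Qed.

Definition twist_tensor : tensor_functor B :=
  @TensorFunctor L B (twist_mod e) twist_tens twist_tens_balanced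
    twist_tens_univ twist_tens_scale twist_tens_map.

End TwistTensor.

Section Nakayama.
Variables (R : comPzRingType) (L : ralgebra R).

(* A derived functor of L^vee \otimes_L -; the tensor functor and its derived
   functor are unique up to isomorphism. *)
Record derived_nakayama := DerivedNakayama {
  nk_tensor : tensor_functor (canonical_bimodule L);
  nk_fun :> functor (Dminus L) (Dminus L);
  nk_counit : nat_trans
    (functor_comp nk_fun (loc_functor (@quasi_iso L)))
    (functor_comp (loc_functor (@quasi_iso L)) (tensor_cx nk_tensor));
  nk_derived : is_left_derived nk_counit
}.

Definition serre (nu : derived_nakayama) : functor (Dminus L) (Dminus L) :=
  functor_comp nu (shift L 1).

End Nakayama.

(* Main.v *)
From Corelib Require Import Setoid Morphisms.
From HB Require Import structures.
From mathcomp Require Import all_boot all_order all_algebra.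
From mathcomp Require Import boolp zify.
Require Import Defs.

Set Implicit Arguments.
Unset Strict Implicit.
Unset Printing Implicit Defensive.

Import GRing.Theory.
Local Open Scope ring_scope.

(** Write sigma for the permutation of the arrows and n(a) for the length of
    the sigma-orbit of a.  The ribbon graph order Lambda is twisted-symmetric: it
    carries a nondegenerate R-linear form phi : Lambda -> R with
    phi (x e(y)) = phi (y x) for an involution e.  Then b |-> (x |-> phi (x b)) is an isomorphism of
    bimodules from Lambda_e to the canonical bimodule Hom_R(Lambda, R), so that
    tensoring with the canonical bimodule is restriction of scalars along e.

    The form is a signed residue.  Give the two arrows starting at each vertex
    opposite signs s(a).  The coefficient of t^m in phi(x) is the sum over all
    arrows a of s(a) times the coefficient in x of the power c_a^(m+1) of the
    cycle starting with a ([form]).  Multiplication by t turns c_a^m into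
    c_a^(m+1), and the trivial path at v into the sum of the two cycles at v;
    since their signs cancel, phi is R-linear ([form_linear]).  If the product
    qp of two paths is a power of c_a, with p starting with a, then pq is a
    power of c_b, where b is the arrow that continues p.  Hence phi (qp) and
    phi (pq) differ by the sign s(a)s(b), and e multiplies p by this sign
    ([sign_twist], [form_twist]).  The form is nondegenerate because every path
    p has a complement q with qp a power of a cycle, so that the coefficient of
    p in b is read off from phi (q b) ([form_run]).  The same formula produces
    b from a given functional f; it is consistent because
    f (c_a) + f (c_b) = t f (1_v) has no constant term when a and b are the
    arrows starting at v ([dual_coefs]), and f is determined by its values on
    paths because Lambda is finite modulo t ([dual_eq0]).

    The functor induced by e acts termwise on complexes and preserves
    quasi-isomorphisms, so it is its own left derived functor
    ([iso_is_left_derived]), and left derived functors are unique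
    ([left_derived_unique]).  Finally twisting by e and shifting, done twice, is
    the shift by two, because e is an involution and the two signs of the
    differentials cancel ([twist_shift_square]). *)

(** * Natural isomorphisms *)

#[local] Instance heq_equivalence (C : category) (x y : C) :
  Equivalence (@heq C x y).
Proof.
split; [exact: heq_refl | exact: heq_sym | exact: heq_trans].
Qed.

#[local] Instance hcomp_proper (C : category) (x y z : C) :
  Proper (@heq C y z ==> @heq C x y ==> @heq C x z) hcomp.
Proof. by move=> f f' ef g g' eg; apply: hcomp_congr. Qed.

#[local] Instance fmap_proper (C D : category) (F : functor C D) (x y : C) :
  Proper (@heq C x y ==> @heq D (F x) (F y)) (fmap F).
Proof. by move=> f g; apply: fmap_congr. Qed.

#[local] Hint Resolve heq_refl : core.

Lemma is_iso_comp (C : category) (x y z : C) (f : hom y z) (g : hom x y) :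
  is_iso f -> is_iso g -> is_iso (hcomp f g).
Proof.
move=> [f' [ff' f'f]] [g' [gg' g'g]]; exists (hcomp g' f'); split.
  by rewrite -hcompA (hcompA g) gg' hcomp1l ff'.
by rewrite -hcompA (hcompA f') f'f hcomp1l g'g.
Qed.

Lemma is_iso_fmap (C D : category) (F : functor C D) (x y : C) (f : hom x y) :
  is_iso f -> is_iso (fmap F f).
Proof.
by move=> [g [fg gf]]; exists (fmap F g); split; rewrite -fmapM ?fg ?gf fmap1.
Qed.

Lemma nat_iso_inv (C D : category) (F G : functor C D) (a : nat_trans F G) :
  (forall x, is_iso (a x)) ->
  exists b : nat_trans G F, forall x,
    heq (hcomp (a x) (b x)) (idm (G x)) /\ heq (hcomp (b x) (a x)) (idm (F x)).
Proof.
move=> /(_ _)/cid ia; pose b x := sval (ia x).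
have ab x : heq (hcomp (a x) (b x)) (idm (G x)) by case: (svalP (ia x)).
have ba x : heq (hcomp (b x) (a x)) (idm (F x)) by case: (svalP (ia x)).
have n (x y : C) (f : hom x y) :
    heq (hcomp (b y) (fmap G f)) (hcomp (fmap F f) (b x)).
  rewrite -[X in heq X]hcomp1r -(ab x) -hcompA (hcompA (fmap G f)) -nt_nat.
  by rewrite -!hcompA hcompA ba hcomp1l.
by exists (NatTrans n).
Qed.

Lemma functor_iso_trans (C D : category) (F G H : functor C D) :
  functor_iso F G -> functor_iso G H -> functor_iso F H.
Proof.
move=> [a ia] [b ib].
have n (x y : C) (f : hom x y) :
    heq (hcomp (hcomp (b y) (a y)) (fmap F f))
        (hcomp (fmap H f) (hcomp (b x) (a x))).
  by rewrite -hcompA nt_nat hcompA nt_nat -hcompA.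
by exists (NatTrans n) => x /=; apply: is_iso_comp.
Qed.

Lemma functor_iso_refl (C D : category) (F : functor C D) : functor_iso F F.
Proof.
have n (x y : C) (f : hom x y) :
  heq (hcomp (idm (F y)) (fmap F f)) (hcomp (fmap F f) (idm (F x))).
  by rewrite hcomp1l hcomp1r.
by exists (NatTrans n) => x; exists (idm _); rewrite /= hcomp1l.
Qed.

Lemma functor_iso_comp (C D E : category) (G G' : functor D E)
    (F F' : functor C D) :
  functor_iso G G' -> functor_iso F F' ->
  functor_iso (functor_comp G F) (functor_comp G' F').
Proof.
move=> [b ib] [a ia].
have n (x y : C) (f : hom x y) :
    heq (hcomp (hcomp (fmap G' (a y)) (b (F y))) (fmap (functor_comp G F) f))
        (hcomp (fmap (functor_comp G' F') f) (hcomp (fmap G' (a x)) (b (F x)))).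
  by rewrite /= -hcompA nt_nat !hcompA -!fmapM nt_nat.
exists (@NatTrans _ _ (functor_comp G F) (functor_comp G' F')
          (fun x => hcomp (fmap G' (a x)) (b (F x))) n) => x.
exact: is_iso_comp (is_iso_fmap G' (ia x)) (ib (F x)).
Qed.

(** * Functors on a localization *)

Section LocalizationNat.
Variables (C E : category) (W : forall x y : C, hom x y -> Prop).
Variables (F G : functor (localization W) E).

(** Naturality passes from a morphism w to its formal inverse: compose the
    square of w with F(w)^-1 on one side and with G(w)^-1 on the other. *)
Lemma zigzag_natural (a : forall x : C, hom (F x) (G x)) :
  (forall (x y : C) (f : hom x y),
     heq (hcomp (a y) (fmap F (ZFwd W f))) (hcomp (fmap G (ZFwd W f)) (a x))) ->
  forall (x y : localization W) (u : hom x y),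
    heq (hcomp (a y) (fmap F u)) (hcomp (fmap G u) (a x)).
Proof.
move=> aF x y; elim=> {x y} [x|x y f|x y w hw|x y z u IHu v IHv].
- rewrite [X in hcomp _ X](fmap1 F x) [X in heq _ (hcomp X _)](fmap1 G x).
  by rewrite hcomp1l hcomp1r.
- exact: aF.
- have FK : heq (hcomp (fmap F (ZFwd W w)) (fmap F (ZInv hw))) (idm (F y)).
    by rewrite -fmapM; apply: heq_trans (fmap_congr F (zeq_invr hw)) (fmap1 F y).
  have GK : heq (hcomp (fmap G (ZInv hw)) (fmap G (ZFwd W w))) (idm (G x)).
    by rewrite -fmapM; apply: heq_trans (fmap_congr G (zeq_invl hw)) (fmap1 G x).
  rewrite -[X in heq X]hcomp1l -GK -hcompA (hcompA _ (a x)) -aF.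
  by rewrite -(hcompA _ _ (fmap F (ZInv hw))) FK hcomp1r.
- rewrite [X in hcomp _ X](fmapM F u v) [X in heq _ (hcomp X _)](fmapM G u v).
  by rewrite hcompA IHu -hcompA IHv hcompA.
Qed.

End LocalizationNat.

Lemma loc_functor_iso (C E : category) (W : forall x y : C, hom x y -> Prop)
    (F G : functor (localization W) E)
    (a : nat_trans (functor_comp F (loc_functor W))
                   (functor_comp G (loc_functor W))) :
  (forall x, is_iso (a x)) -> functor_iso F G.
Proof.
move=> ia; exists (NatTrans (zigzag_natural (nt_nat a))); exact: ia.
Qed.

Section LeftDerived.
Variables (C C' : category) (W : forall x y : C, hom x y -> Prop).
Variables (W' : forall x y : C', hom x y -> Prop) (F : functor C C').

(** When F already descends to LF on the localizations, the factorization of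
    gam through eta can only be eta^-1 gam. *)
Lemma iso_is_left_derived (LF : functor (localization W) (localization W'))
    (eta : nat_trans (functor_comp LF (loc_functor W))
                     (functor_comp (loc_functor W') F)) :
  (forall x, is_iso (eta x)) -> is_left_derived eta.
Proof.
move=> eta_iso G gam; split; last first.
  move=> a b ha hb x; have [i [_ ie]] := eta_iso x.
  rewrite -[X in heq X]hcomp1l -[X in heq _ X]hcomp1l -ie -!hcompA.
  by rewrite (ha x) (hb x).
have [i hi] := nat_iso_inv eta_iso.
have n (x y : C) (f : hom x y) :
    heq (hcomp (hcomp (i y) (gam y)) (fmap G (ZFwd W f)))
        (hcomp (fmap LF (ZFwd W f)) (hcomp (i x) (gam x))).
  by rewrite -hcompA (nt_nat gam f) hcompA (nt_nat i f) -hcompA.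
exists (NatTrans (zigzag_natural n)) => x.
change (heq (hcomp (eta x) (hcomp (i x) (gam x))) (gam x)).
by rewrite hcompA (hi x).1 hcomp1l.
Qed.

Lemma left_derived_unique (LF LF' : functor (localization W) (localization W'))
    (eta : nat_trans (functor_comp LF (loc_functor W))
                     (functor_comp (loc_functor W') F))
    (eta' : nat_trans (functor_comp LF' (loc_functor W))
                      (functor_comp (loc_functor W') F)) :
  is_left_derived eta -> is_left_derived eta' -> functor_iso LF LF'.
Proof.
move=> d d'.
have [[b hb] _] := d _ eta'; have [[a ha] _] := d' _ eta.
have nid (H : functor (localization W) (localization W')) x y
    (f : @hom (localization W) x y) :
  heq (hcomp (idm (H y)) (fmap H f)) (hcomp (fmap H f) (idm (H x))).
  by rewrite hcomp1l hcomp1r.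
have nab (H H' : functor (localization W) (localization W'))
    (u : nat_trans H' H) (v : nat_trans H H') x y
    (f : @hom (localization W) x y) :
  heq (hcomp (hcomp (u y) (v y)) (fmap H f))
      (hcomp (fmap H f) (hcomp (u x) (v x))).
  by rewrite -hcompA nt_nat hcompA nt_nat -hcompA.
exists a => x; exists (b x); split.
- apply: ((d' _ eta').2 (NatTrans (nab _ _ a b)) (NatTrans (nid LF'))) => z.
    change (heq (hcomp (eta' z) (hcomp (a z) (b z))) (eta' z)).
    by rewrite hcompA (ha z) (hb z).
  exact: hcomp1r.
- apply: ((d _ eta).2 (NatTrans (nab _ _ b a)) (NatTrans (nid LF))) => z.
    change (heq (hcomp (eta z) (hcomp (b z) (a z))) (eta z)).
    by rewrite hcompA (hb z) (ha z).
  exact: hcomp1r.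
Qed.
End LeftDerived.

(** * Tensor functors *)

Section Tensor.
Variables (A : pzRingType) (B : bimodule A).

Lemma tensor_ext (T : tensor_functor B) (M : fgmod A) (G : zmodType)
    (u v : {additive (T M : fgmod A) -> G}) :
  (forall b m, u (tf_tens T b m) = v (tf_tens T b m)) -> u =1 v.
Proof.
move=> uv; have [tDl tDr tA] := tf_balanced T M.
have bal : balanced (fun b m => v (tf_tens T b m)).
  by split=> *; rewrite ?tDl ?tDr ?tA ?raddfD.
have [w _ uw] := tf_univ T bal; move=> x.
by rewrite (uw u uv) (uw v).
Qed.

(** Additivity comes from the universal property.  Linearity holds because
    u (a x) and a (u x) are additive in x and agree on pure tensors. *)
Lemma tensor_compare (T T' : tensor_functor B) (M : fgmod A) :
  exists u : {linear (T M : fgmod A) -> (T' M : fgmod A)},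
    forall b m, u (tf_tens T b m) = tf_tens T' b m.
Proof.
have [u hu _] := tf_univ T (tf_balanced T' M).
have uZ : scalable u.
  move=> a.
  have D1 : zmod_morphism (fun x : (T M : fgmod A) => u (a *: x)).
    by move=> x y; rewrite scalerBr raddfB.
  have D2 : zmod_morphism (fun x : (T M : fgmod A) => a *: u x).
    by move=> x y; rewrite raddfB scalerBr.
  pose u1 : {additive (T M : fgmod A) -> (T' M : fgmod A)} := HB.pack
    (fun x : (T M : fgmod A) => u (a *: x)) (GRing.isZmodMorphism.Build _ _ _ D1).
  pose u2 : {additive (T M : fgmod A) -> (T' M : fgmod A)} := HB.pack
    (fun x : (T M : fgmod A) => a *: u x) (GRing.isZmodMorphism.Build _ _ _ D2).
  suff: u1 =1 u2 by [].
  by apply: tensor_ext => b m /=; rewrite -tf_scale !hu -tf_scale.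
pose v : {linear (T M : fgmod A) -> (T' M : fgmod A)} :=
  HB.pack (u : _ -> _) (GRing.Additive.on (u : _ -> _))
    (GRing.isScalable.Build _ _ _ _ _ uZ).
by exists v.
Qed.

Lemma tensor_functor_unique (T T' : tensor_functor B) : functor_iso T T'.
Proof.
have cmp (S S' : tensor_functor B) :
    exists u : nat_trans S S', forall (M : fgmod A) b (m : M),
      (u M : {linear _ -> _}) (tf_tens S b m) = tf_tens S' b m.
  have w M := cid (tensor_compare S S' M).
  pose u M := sval (w M); have hu M b m : u M (tf_tens S b m) = tf_tens S' b m.
    exact: (svalP (w M)).
  have n (M N : modcat A) (f : hom M N) :
    @heq (modcat A) _ _ (@hcomp (modcat A) _ _ _ (u N) (fmap S f))
                        (@hcomp (modcat A) _ _ _ (fmap S' f) (u M)).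
    apply: tensor_ext => b m /=.
    by rewrite [X in u N X](tf_map S f) !hu [RHS](tf_map S' f).
  by exists (NatTrans n).
have [u hu] := cmp T T'; have [v hv] := cmp T' T.
exists u => M; exists (v M); split.
  apply: (@tensor_ext T' M _ (@hcomp (modcat A) _ _ _ (u M) (v M)) idfun).
  by move=> b m /=; rewrite hv hu.
apply: (@tensor_ext T M _ (@hcomp (modcat A) _ _ _ (v M) (u M)) idfun).
by move=> b m /=; rewrite hu hv.
Qed.

Section Transport.
Variables (B' : bimodule A) (T : tensor_functor B').
Variables (th : {linear B' -> B}) (ps : B -> B').
Hypothesis thR : forall b a, th (bm_ract b a) = bm_ract (th b) a.
Hypotheses (thK : cancel th ps) (psK : cancel ps th).

Let psD b b' : ps (b + b') = ps b + ps b'.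
Proof. by apply: (can_inj thK); rewrite linearD !psK. Qed.
Let psZ a b : ps (a *: b) = a *: ps b.
Proof. by apply: (can_inj thK); rewrite linearZ /= !psK. Qed.
Let psR b a : ps (bm_ract b a) = bm_ract (ps b) a.
Proof. by apply: (can_inj thK); rewrite thR !psK. Qed.

Definition tensor_transport : tensor_functor B.
refine (@TensorFunctor A B T (fun M b m => tf_tens T (ps b) m) _ _ _ _).
- move=> M; have [tDl tDr tA] := tf_balanced T M.
  by split=> *; rewrite ?psD ?psR ?tDl ?tDr ?tA.
- move=> M G beta [bDl bDr bA].
  have bal : @balanced A B' M G (fun b m => beta (th b) m).
    by split=> *; rewrite ?linearD ?thR ?bDl ?bDr ?bA.
  have [u hu uu] := tf_univ T bal; exists u => [b m|u' hu'].
    by rewrite hu psK.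
  by apply: uu => b m; rewrite -{1}(thK b) hu'.
- by move=> M a b m; rewrite psZ tf_scale.
- by move=> M N f b m; rewrite tf_map.
Defined.

End Transport.
End Tensor.

Lemma map_cx_iso (A : pzRingType) (T T' : functor (modcat A) (modcat A)) T0 T0' :
  functor_iso T T' -> functor_iso (@map_cx A T T0) (@map_cx A T' T0').
Proof.
move=> [a /nat_iso_inv[b ab]].
have cd (S S' : functor (modcat A) (modcat A)) S0 S0' (c : nat_trans S S') :
    exists u : nat_trans (@map_cx A S S0) (@map_cx A S' S0'),
      forall X i, (u X : cmap _ _) i = c (X i : modcat A).
  have d (X : complex A) i j x : (c (X j) : {linear _ -> _}) (map_d S X i j x)
      = map_d S' X i j ((c (X i) : {linear _ -> _}) x).
    exact: (nt_nat c (cx_d X i j : @hom (modcat A) _ _) x).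
  pose u (X : complex A) := @CMap A (map_complex S0 X) (map_complex S0' X)
    (fun i => c (X i)) (d X).
  have n (X Y : cxcat A) (f : hom X Y) : @heq (cxcat A) _ _
      (@hcomp (cxcat A) _ _ _ (u Y) (fmap (@map_cx A S S0) f))
      (@hcomp (cxcat A) _ _ _ (fmap (@map_cx A S' S0') f) (u X)).
    by move=> i x; apply: (nt_nat c ((f : cmap X Y) i : @hom (modcat A) _ _) x).
  by exists (@NatTrans _ _ (@map_cx A S S0) (@map_cx A S' S0') u n).
have [u hu] := cd T T' T0 T0' a; have [v hv] := cd T' T T0' T0 b.
exists u => X; exists (v X); split=> i x /=; rewrite hu hv.
  exact: (ab (X i)).1.
exact: (ab (X i)).2.
Qed.

Lemma cmap_iso (A : pzRingType) (X Y : complex A) (f : cmap X Y)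
    (g : forall i, Y i -> X i) :
  (forall i, cancel (f i) (g i)) -> (forall i, cancel (g i) (f i)) ->
  @is_iso (cxcat A) X Y f.
Proof.
move=> fK gK.
pose h i : {linear Y i -> X i} :=
  HB.pack (g i) (GRing.isLinear.Build _ _ _ _ (g i) (can2_linear (fK i) (gK i))).
have hd i j x : h j (cx_d Y i j x) = cx_d X i j (h i x).
  by apply: (can_inj (fK j)); rewrite cm_d /= !gK.
by exists (CMap hd); split=> i x /=; [apply: gK | apply: fK].
Qed.

(** * The Nakayama functor of a twisted-symmetric algebra *)

Section Nakayama.
Variables (R : comPzRingType) (L : ralgebra R) (e : involution L).

Section Counit.
Variable T : tensor_functor (canonical_bimodule L).
Hypothesis eT : functor_iso (twist_mod e) T.

(** On complexes the localization of [twist_cx e] is [twist_cx e] itself, so a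
    termwise isomorphism with T is already a counit. *)
Lemma twist_counit : exists eta : nat_trans
    (functor_comp (twist e) (loc_functor (@quasi_iso L)))
    (functor_comp (loc_functor (@quasi_iso L)) (tensor_cx T)),
  is_left_derived eta.
Proof.
have [c ic] : functor_iso (functor_comp (loc_functor (@quasi_iso L)) (twist_cx e))
    (functor_comp (loc_functor (@quasi_iso L)) (tensor_cx T)).
  by apply: functor_iso_comp (map_cx_iso _ _ eT); apply: functor_iso_refl.
pose eta := @NatTrans _ _
  (functor_comp (twist e) (loc_functor (@quasi_iso L)))
  (functor_comp (loc_functor (@quasi_iso L)) (tensor_cx T)) (nt c) (nt_nat c).
by exists eta; apply: iso_is_left_derived; apply: ic.
Qed.
End Counit.

Section Cast.
Variable X : complex L.

(** The components of X[1][1] and of X[2] sit at the degrees i + 1 + 1 and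
    i + 2, which are equal but not convertible. *)
Definition cast_deg i j (h : i = j) : {linear X i -> X j} :=
  match h in _ = j return {linear X i -> X j} with erefl => idfun end.

Lemma cast_degK i j (h : i = j) : cancel (cast_deg h) (cast_deg (esym h)).
Proof. by case: j / h. Qed.
Lemma cast_degKV i j (h : i = j) : cancel (cast_deg (esym h)) (cast_deg h).
Proof. by case: j / h. Qed.

Lemma cast_deg_d i j i' j' (hi : i = i') (hj : j = j') x :
  cast_deg hj (cx_d X i j x) = cx_d X i' j' (cast_deg hi x).
Proof. by case: i' / hi; case: j' / hj. Qed.
End Cast.

Lemma cast_deg_cmap (X Y : complex L) (f : cmap X Y) i j (h : i = j) x :
  cast_deg Y h (f i x) = f j (cast_deg X h x).
Proof. by case: j / h. Qed.

Section Untwist.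
Variable M : fgmod L.
Definition untwist (x : twist_fgmod e (twist_fgmod e M)) : M := x.
Fact untwist_linear : linear untwist.
Proof.
move=> a x y; rewrite /untwist {1}/GRing.scale /= /twisted_scale.
by rewrite {1}/GRing.scale /= /twisted_scale inv_involutive.
Qed.
HB.instance Definition _ :=
  GRing.isLinear.Build L (twist_fgmod e (twist_fgmod e M)) M *:%R untwist
    untwist_linear.
End Untwist.

Local Notation tw_shift := (functor_comp (twist e) (shift L 1)).

Lemma twist_shift_square :
  functor_iso (functor_comp tw_shift tw_shift) (shift L 2).
Proof.
have deg2 (i : int) : i + 1 + 1 = i + 2 by rewrite -addrA.
pose tw_shift_cx := functor_comp (twist_cx e) (shift_cx L 1).
pose F := functor_comp tw_shift_cx tw_shift_cx.
pose iota (X : complex L) i :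
    {linear (F X : complex L) i -> shift_complex 2 X i} :=
  cast_deg X (deg2 i) \o @untwist (X (i + 1 + 1)).
have d X i j x :
    iota X j (cx_d (F X) i j x) = cx_d (shift_complex 2 X) i j (iota X i x).
  (* The outer sign acts on a module twisted once, hence through e. *)
  change (cast_deg X (deg2 j)
            (e ((-1) ^+ 1) *:
              ((-1) ^+ 1 *: cx_d X (i + 1 + 1) (j + 1 + 1) x)) =
          (-1) ^+ 2 *: cx_d X (i + 2) (j + 2) (cast_deg X (deg2 i) x)).
  by rewrite expr1 sqrrN expr1n rmorphN1 !scaleN1r opprK scale1r cast_deg_d.
pose u X := CMap (d X).
have n (X Y : cxcat L) (f : hom X Y) : @heq (cxcat L) _ _
    (@hcomp (cxcat L) _ _ _ (u Y) (fmap F f))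
    (@hcomp (cxcat L) _ _ _ (fmap (shift_cx L 2) f) (u X)).
  by move=> i x /=; rewrite /untwist -cast_deg_cmap.
have [a ia] : functor_iso
    (functor_comp (loc_functor (@quasi_iso L)) F)
    (functor_comp (loc_functor (@quasi_iso L)) (shift_cx L 2)).
  apply: functor_iso_comp; first exact: functor_iso_refl.
  exists (@NatTrans _ _ F (shift_cx L 2) u n) => X.
  apply: (@cmap_iso L (F X) (shift_complex 2 X) (u X)
            (fun i (x : X (i + 2)) => cast_deg X (esym (deg2 i)) x)).
    by move=> i x /=; rewrite cast_degK.
  by move=> i x /=; rewrite /untwist cast_degKV.
pose a' := @NatTrans _ _
  (functor_comp (functor_comp tw_shift tw_shift) (loc_functor (@quasi_iso L)))
  (functor_comp (shift L 2) (loc_functor (@quasi_iso L))) (nt a) (nt_nat a).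
exact: (@loc_functor_iso _ _ _ _ _ a').
Qed.

Section FromBimodule.
Variables (th : {linear twisted_bimodule e -> canonical_bimodule L}).
Variables (ps : canonical_bimodule L -> twisted_bimodule e).
Hypothesis thR : forall b a, th (bm_ract b a) = bm_ract (th b) a.
Hypotheses (thK : cancel th ps) (psK : cancel ps th).

Lemma derived_nakayama_exists : inhabited (derived_nakayama L).
Proof.
pose T := tensor_transport (twist_tensor e) thR thK psK.
have [eta d] := @twist_counit T (functor_iso_refl _).
exact: inhabits (DerivedNakayama d).
Qed.

Lemma derived_nakayama_twist (nu : derived_nakayama L) : functor_iso nu (twist e).
Proof.
pose T := tensor_transport (twist_tensor e) thR thK psK.
have [eta d] := twist_counit (tensor_functor_unique T (nk_tensor nu)).
exact: left_derived_unique (@nk_derived _ _ nu) d.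
Qed.

Lemma serre_twist (nu : derived_nakayama L) : functor_iso (serre nu) tw_shift.
Proof.
exact: functor_iso_comp (derived_nakayama_twist nu) (functor_iso_refl _).
Qed.

Lemma serre_square (nu : derived_nakayama L) :
  functor_iso (functor_comp (serre nu) (serre nu)) (shift L 2).
Proof.
apply: functor_iso_trans twist_shift_square.
by apply: functor_iso_comp; apply: serre_twist.
Qed.

End FromBimodule.
End Nakayama.

(** * Power series *)

Section PowerSeries.
Variable k : fieldType.
Implicit Types (f : fps k) (c : k).

Definition fpsC c : fps k := FPS (fun n => if n is 0 then c else 0).
Definition fpsX : fps k := FPS (fun n => (n == 1)%:R).

Lemma fps_coefD f g n : fps_coef (f + g) n = fps_coef f n + fps_coef g n.
Proof. by []. Qed.

Lemma fps_coefB f g n : fps_coef (f - g) n = fps_coef f n - fps_coef g n.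
Proof. by []. Qed.

Lemma fps_coef_sum I (r : seq I) P (F : I -> fps k) n :
  fps_coef (\sum_(i <- r | P i) F i) n = \sum_(i <- r | P i) fps_coef (F i) n.
Proof. exact: (big_morph (fun f => fps_coef f n)). Qed.

Lemma fps_coefCM c f n : fps_coef (fpsC c * f) n = c * fps_coef f n.
Proof. by rewrite /= big_ord_recl subn0 big1 ?addr0 // => i _; rewrite mul0r. Qed.

Lemma fps_coefXM0 f : fps_coef (fpsX * f) 0 = 0.
Proof. by rewrite /= big_ord1 mul0r. Qed.

Lemma fps_coefXMS f n : fps_coef (fpsX * f) n.+1 = fps_coef f n.
Proof.
rewrite /= big_ord_recl mul0r add0r big_ord_recl mul1r subSS subn0.
by rewrite big1 ?addr0 // => i _; rewrite mul0r.
Qed.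

Lemma fps_coefXnM j f n : fps_coef (fpsX ^+ j * f) (n + j) = fps_coef f n.
Proof.
elim: j => [|j IHj]; first by rewrite mul1r addn0.
by rewrite exprS -mulrA addnS fps_coefXMS.
Qed.

Lemma fps_coefXnM_lt j f n : (n < j)%N -> fps_coef (fpsX ^+ j * f) n = 0.
Proof.
elim: j n => // j IHj [|n] ltnj; rewrite exprS -mulrA ?fps_coefXM0 //.
by rewrite fps_coefXMS IHj.
Qed.

Lemma fpsXI f g : fpsX * f = fpsX * g -> f = g.
Proof. by move=> e; apply: fpsP => n; rewrite -[LHS]fps_coefXMS e fps_coefXMS. Qed.

Lemma fps_split f :
  f = fpsC (fps_coef f 0) + fpsX * FPS (fun n => fps_coef f n.+1).
Proof.
apply: fpsP => n; rewrite fps_coefD.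
by case: n => [|n]; rewrite ?fps_coefXM0 ?addr0 // fps_coefXMS add0r.
Qed.

End PowerSeries.

(** * Paths of a complete gentle quiver *)

Section GentlePaths.
Variables (Q : bound_quiver) (gQ : complete_gentle Q).
Local Notation sg := (@sigma Q).
Local Notation ord := (order sg).
Implicit Types (a b c : arr Q).

Let sgI : injective sg := sigma_inj gQ.

Fact run_word_ok a L : word_ok (src (iter L sg a)) (rev (traject sg a L)).
Proof.
case: L => // L; rewrite trajectSr rev_rcons /= (src_sigma gQ) eqxx /=.
by elim: L => // L IHL; rewrite trajectSr rev_rcons /= (sigmaP gQ) eqxx.
Qed.

(** The path that starts with a and has length L.  Every path of positive length
    is [run a L] for a unique a, while [run a 0] is the trivial path at [src a],
    which the two arrows starting there share ([run_surj], [run_inj],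
    [run0]). *)
Definition run a L : qpath Q := QPath (run_word_ok a L).

Lemma plen_run a L : plen (run a L) = L.
Proof. by rewrite /plen size_rev size_traject. Qed.

Lemma psrc_run a L : psrc (run a L) = src a.
Proof.
by case: L => //= L; rewrite /psrc /psrc_aux /= rev_cons map_rcons last_rcons.
Qed.

Lemma drop_traject a i j :
  drop i (traject sg a (i + j)) = traject sg (iter i sg a) j.
Proof. by rewrite trajectD drop_size_cat ?size_traject. Qed.

Lemma pleft_run a i j : pleft (run a (i + j)) j = run (iter i sg a) j.
Proof.
apply: qpathP => /=; first by rewrite -iterD addnC.
by rewrite take_rev size_traject addnK drop_traject.
Qed.

Lemma pright_run a i j : pright (run a (i + j)) j = run a i.
Proof.
apply: qpathP => /=.
  have := congr1 (@pword Q) (pleft_run a i j); rewrite /= => ->.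
  have := psrc_run (iter i sg a) j; rewrite /psrc /=.
  by rewrite -iterD addnC.
by rewrite drop_rev size_traject addnK trajectD take_size_cat ?size_traject.
Qed.

Lemma arrow_from (v : vtx Q) : exists a, src a = v.
Proof.
have : (0 < #|[set a | src a == v]|)%N by rewrite two_starting.
by case/card_gt0P => a; rewrite inE => /eqP; exists a.
Qed.

Lemma run_surj p : exists a, p = run a (plen p).
Proof.
have [p0|p_gt0] := posnP (plen p).
  have [a ea] := arrow_from (ptgt p); exists a; apply: qpathP; rewrite p0 //=.
  exact: size0nil.
have [||a ea] := @rev_word Q gQ (pword p).
- by move=> e; move: p_gt0; rewrite /plen e.
- by exists (ptgt p); apply: pwordP.
exists a; rewrite /plen; apply: qpathP; last by rewrite /= -ea revK.
have := pwordP p; rewrite -[pword p]revK ea size_rev size_traject.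
rewrite -/(plen p) -(prednK p_gt0) trajectSr rev_rcons /= => /andP[/eqP<- _].
by rewrite (src_sigma gQ).
Qed.

Lemma run_inj a b L M : (0 < L)%N -> run a L = run b M -> a = b /\ L = M.
Proof.
move=> L_gt0 e; have eL : L = M by rewrite -(plen_run a L) e plen_run.
split=> //; have : rev (pword (run a L)) = rev (pword (run b M)) by rewrite e.
by rewrite /= !revK -eL; case: (L) L_gt0 => //= L' _ [].
Qed.

Lemma run0 a b : src a = src b -> run a 0 = run b 0.
Proof. by move=> e; apply: qpathP. Qed.

Lemma ord_gt0 a : (0 < ord a)%N. Proof. exact: order_gt0. Qed.
Lemma ord_iter i a : ord (iter i sg a) = ord a. Proof. exact: order_iter. Qed.

Lemma iter_sigma_inj i : injective (iter i sg).
Proof. by elim: i => // i IHi a b /sgI /IHi. Qed.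

Lemma iter_ordM m a : iter (m * ord a) sg a = a.
Proof.
elim: m => // m IHm; rewrite mulSn iterD IHm; exact: iter_order.
Qed.

(** * Multiplication by the sum of the cycles *)

Section Coefficients.
Variable k : fieldType.
Local Notation Lam := (pseries k Q).
Local Notation z := (cyc_sum k Q).
Implicit Types (x y f g : Lam).

Lemma run_ext f g :
  (forall a L, pcoef f (run a L) = pcoef g (run a L)) -> f = g.
Proof. by move=> e; apply: pseriesP => p; have [a ->] := run_surj p. Qed.

(** The condition at length 0 says that the two arrows starting at a vertex
    prescribe the same coefficient of its trivial path. *)
Lemma run_coefs (F : arr Q -> nat -> k) :
  (forall a b, src a = src b -> F a 0 = F b 0) ->
  exists x : Lam, forall a L, pcoef x (run a L) = F a L.
Proof.
move=> F0; pose r p := sval (cid (run_surj p)).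
have rP p : p = run (r p) (plen p) by exact: svalP (cid (run_surj p)).
exists (PSeries (fun p => F (r p) (plen p))) => a L /=.
have := rP (run a L); rewrite plen_run; case: L => [|L] e.
  by apply: F0; rewrite -(psrc_run a 0) [in RHS]e psrc_run.
by have [<- _] := run_inj (ltn0Sn L) e.
Qed.

Lemma coef_runM f g a L : pcoef (f * g) (run a L) =
  \sum_(i < L.+1) pcoef f (run (iter i sg a) (L - i)) * pcoef g (run a i).
Proof.
rewrite pcoefM plen_run (reindex_inj rev_ord_inj) /=.
apply: eq_bigr => i _; have le_iL : (i <= L)%N by rewrite -ltnS.
rewrite subSS; congr (pcoef f _ * pcoef g _).
  by rewrite -{1}(subnKC le_iL) pleft_run.
by rewrite -{1}(subnKC le_iL) pright_run.
Qed.

Lemma coef_run_cyc a L : pcoef z (run a L) = (L == ord a)%:R.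
Proof. by apply: pcoef_cyc_sum; rewrite revK. Qed.

Lemma coef_run_cycM f a L : pcoef (z * f) (run a L) =
  if (ord a <= L)%N then pcoef f (run a (L - ord a)) else 0.
Proof.
rewrite (cyc_sumC gQ) coef_runM; case: leqP => [le|lt].
  rewrite (big_only1 (Ordinal (le : ord a < L.+1)%N)) // => [|i ne _].
    by rewrite coef_run_cyc eqxx mulr1 (iter_order sgI).
  by rewrite coef_run_cyc [_ == _](negPf ne) mulr0.
apply: big1 => i _; rewrite coef_run_cyc ltn_eqF ?mulr0 //.
by apply: leq_ltn_trans lt; rewrite -ltnS.
Qed.

Lemma cyc_evalX : cyc_eval Q (fpsX k) = z.
Proof.
apply: pseriesP => p; rewrite (@cyc_eval_widen _ _ _ _ (plen p).+1) //.
rewrite big_ord_recl mul0r add0r big_ord_recl mul1r big1 ?addr0 // => i _.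
by rewrite mul0r.
Qed.

Lemma coef_fpsCM (c : k) f p :
  pcoef (cyc_eval Q (fpsC c) * f) p = c * pcoef f p.
Proof.
have e q : pcoef (cyc_eval Q (fpsC c)) q = c * (plen q == 0)%:R.
  by rewrite /= big_ord_recl big1 ?addr0 // => i _; rewrite mul0r.
rewrite pcoefM big_ord_recl e plen_left // mulr1 pright0 big1 ?addr0 // => i _.
by rewrite e plen_left /= ?mulr0 ?mul0r.
Qed.

Lemma cyc_mono a L :
  (0 < L)%N -> z * mono 1 (run a L) = mono 1 (run a (L + ord a)).
Proof.
move=> L_gt0; apply: run_ext => b M; rewrite coef_run_cycM /=.
case: (run b M =P _) => [/esym e|ne].
  have [<- <-] := run_inj (ltn_addr (ord a) L_gt0) e.
  by rewrite leq_addl addnK eqxx.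
case: leqP => // le; case: eqP => // /esym/(run_inj L_gt0)[ab e]; case: ne.
by rewrite ab e subnK.
Qed.

Lemma cyc_mono0 a : z * mono 1 (run a 0) =
  \sum_(b | src b == src a) mono 1 (run b (ord b)).
Proof.
apply: run_ext => c M; rewrite pcoef_sum coef_run_cycM /=.
have [M0|M_gt0] := posnP M.
  rewrite M0 leqNgt ord_gt0 /= big1 // => b _; case: eqP => // e.
  by have := plen_run c 0; rewrite e plen_run => e0; have := ord_gt0 b; rewrite e0.
have [srcac|neq] := eqVneq (src c) (src a); last first.
  rewrite big1 => [|b /eqP sb].
    case: leqP => // le; case: eqP => // e; case/eqP: neq.
    by rewrite -(psrc_run c (M - ord c)) e psrc_run.
  case: eqP => // e; have [cb _] := run_inj M_gt0 e.
  by rewrite -sb -cb eqxx in neq.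
rewrite (bigD1 c) /= ?srcac // big1 ?addr0 => [|b /andP[_ nbc]]; last first.
  by case: eqP => // e; have [cb _] := run_inj M_gt0 e; rewrite cb eqxx in nbc.
rewrite (run0 (esym srcac)); case: leqP => [le|lt].
  congr (if _ then _ else _).
  apply/eqP/eqP => /(congr1 (@plen Q)); rewrite !plen_run; last first.
    by move=> ->; rewrite subnn.
  move=> /eqP; rewrite subn_eq0 => le'; congr run; apply/eqP.
  by rewrite eqn_leq le le'.
case: eqP => // /(congr1 (@plen Q)); rewrite !plen_run => e.
by rewrite e ltnn in lt.
Qed.

Lemma cyc_eval_split r x : cyc_eval Q r * x =
  cyc_eval Q (fpsC (fps_coef r 0)) * x +
  z * (cyc_eval Q (FPS (fun n => fps_coef r n.+1)) * x).
Proof.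
rewrite -cyc_evalX mulrA -mulrDl; congr (_ * _).
by rewrite {1}(fps_split r) (rmorphD (cyc_eval Q)) (rmorphM (cyc_eval Q)).
Qed.

(** * The form and its Nakayama involution *)

Lemma vertex_signs : exists s : arr Q -> k,
  (forall a, s a * s a = 1) /\ (forall v, \sum_(a | src a == v) s a = 0).
Proof.
pose c v := sval (cid (arrow_from v)).
have cP v : src (c v) = v by exact: svalP (cid (arrow_from v)).
exists (fun a => if a == c (src a) then 1 else -1); split=> [a|v].
  by case: ifP; rewrite ?mulrNN mul1r.
rewrite (bigD1 (c v)) /= ?cP // eqxx.
rewrite (eq_bigr (fun=> -1)) => [|a /andP[/eqP-> /negPf->] //].
rewrite sumr_const; have := two_starting gQ v.
rewrite (cardsD1 (c v)) inE cP eqxx add1n => /succn_inj e.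
rewrite (eq_card (_ : _ =i [set a | src a == v] :\ c v)) ?e ?subrr // => a.
by rewrite !inE andbC.
Qed.

Section Form.
Variable s : arr Q -> k.
Hypothesis sK : forall a, s a * s a = 1.
Hypothesis s_vertex : forall v, \sum_(a | src a == v) s a = 0.

Lemma sum_sign_src (g : vtx Q -> k) : \sum_a s a * g (src a) = 0.
Proof.
rewrite (partition_big (@src Q) xpredT) //= big1 // => v _.
rewrite (eq_bigr (fun a => s a * g v)) => [|a /eqP-> //].
by rewrite -mulr_suml s_vertex mul0r.
Qed.

Definition form x : fps k :=
  FPS (fun m => \sum_a s a * pcoef x (run a (m.+1 * ord a))).

Lemma coef_form x m :
  fps_coef (form x) m = \sum_a s a * pcoef x (run a (m.+1 * ord a)).
Proof. by []. Qed.

Lemma formD x y : form (x + y) = form x + form y.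
Proof.
apply: fpsP => m; rewrite fps_coefD !coef_form -big_split.
by apply: eq_bigr => a _; rewrite pcoefD mulrDr.
Qed.

(** The trivial paths enter the constant term of phi (t x), where the opposite
    signs of the two arrows at each vertex make them cancel. *)
Lemma formX x : form (z * x) = fpsX k * form x.
Proof.
apply: fpsP => -[|m].
  rewrite fps_coefXM0 coef_form -[RHS](sum_sign_src (fun v =>
    pcoef x (@QPath Q v [::] isT))).
  apply: eq_bigr => a _; rewrite mul1n coef_run_cycM leqnn subnn.
  by congr (_ * pcoef x _); apply: qpathP.
rewrite fps_coefXMS !coef_form; apply: eq_bigr => a _.
by rewrite coef_run_cycM mulSn leq_addr addKn.
Qed.

Lemma formC (c : k) x : form (cyc_eval Q (fpsC c) * x) = fpsC c * form x.
Proof.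
apply: fpsP => m; rewrite fps_coefCM !coef_form mulr_sumr; apply: eq_bigr => a _.
by rewrite coef_fpsCM mulrCA.
Qed.

Lemma form_linear r x : form (cyc_eval Q r * x) = r * form x.
Proof.
apply: fpsP => m; elim: m r => [|m IHm] r.
  rewrite cyc_eval_split formD formC formX fps_coefD fps_coefXM0 [in RHS](fps_split r).
  by rewrite mulrDl fps_coefD -mulrA fps_coefXM0.
rewrite cyc_eval_split formD formC formX fps_coefD fps_coefXMS [in RHS](fps_split r).
by rewrite mulrDl fps_coefD -mulrA fps_coefXMS IHm.
Qed.

(** The letters c and [last c w] are the last and the first arrow travelled, so
    the sign compares the first arrow of the path with the arrow that continues
    it; on [run a L] it is s(a) s(sigma^L a), including L = 0
    ([path_sign_run]). *)
Definition path_sign (p : qpath Q) : k :=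
  if pword p is c :: w then s (last c w) * s (sg c) else 1.

Lemma path_sign_run a L : path_sign (run a L) = s a * s (iter L sg a).
Proof.
case: L => [|L]; first by rewrite sK.
rewrite /path_sign /run /pword trajectSr rev_rcons /=; congr (s _ * _).
by case: L => //= L; rewrite rev_cons last_rcons.
Qed.

Lemma path_signK p : path_sign p * path_sign p = 1.
Proof. by have [a ->] := run_surj p; rewrite path_sign_run mulrACA !sK mulr1. Qed.

Definition sign_twist x : Lam := PSeries (fun p => path_sign p * pcoef x p).

Fact sign_twist_zmod : zmod_morphism sign_twist.
Proof. by move=> x y; apply: pseriesP => p; rewrite /= mulrDr mulrN. Qed.

(** The signs of two composable factors multiply to the sign of the product, as
    the sign of the arrow at which they meet occurs twice. *)
Fact sign_twist_monoid : monoid_morphism sign_twist.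
Proof.
split=> [|x y]; apply: run_ext => a L.
  transitivity (path_sign (run a L) * pcoef (1 : Lam) (run a L)) => //.
  rewrite path_sign_run pcoef1 plen_run.
  by case: L => [|L]; rewrite ?sK ?mul1r // mulr0.
transitivity (path_sign (run a L) * pcoef (x * y) (run a L)) => //.
rewrite !coef_runM mulr_sumr.
apply: eq_bigr => i _; rewrite /= !path_sign_run.
rewrite -iterD subnK -1?ltnS //.
rewrite [RHS]mulrACA; congr (_ * _).
by rewrite [s (iter i sg a) * _]mulrC mulrACA sK mulr1 mulrC.
Qed.
HB.instance Definition _ :=
  GRing.isZmodMorphism.Build Lam Lam sign_twist sign_twist_zmod.
HB.instance Definition _ :=
  GRing.isMonoidMorphism.Build Lam Lam sign_twist sign_twist_monoid.

Lemma sign_twistK : involutive sign_twist.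
Proof.
by move=> x; apply: pseriesP => p; rewrite /= mulrA path_signK mul1r.
Qed.

Lemma sign_twist_cyc_sum : sign_twist z = z.
Proof.
apply: run_ext => a L; rewrite [LHS]/= path_sign_run coef_run_cyc.
by case: eqP => [->|_]; rewrite ?mulr0 // (iter_order sgI) sK mulr1.
Qed.

Lemma sign_twist_eval r : sign_twist (cyc_eval Q r) = cyc_eval Q r.
Proof.
apply: pseriesP => p; rewrite /= mulr_sumr; apply: eq_bigr => n _.
rewrite mulrCA; congr (_ * _).
by rewrite -[in RHS]sign_twist_cyc_sum -rmorphXn.
Qed.

Definition ribbon_involution : involution (ribbon_order k gQ) :=
  @Involution _ (ribbon_order k gQ) sign_twist sign_twist_eval sign_twistK.

(** Both sides sum over the ways of cutting a power of a cycle into two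
    factors; cutting after i arrows and rotating replaces the starting arrow a
    by sigma^i(a). *)
Lemma form_twist x y : form (x * sign_twist y) = form (y * x).
Proof.
apply: fpsP => m; rewrite !coef_form.
(* K bounds the lengths N a, so that sums over arrows and positions commute. *)
pose N a := (m.+1 * ord a)%N; pose K := (m.+1 * #|arr Q|)%N.
have leN a : (N a <= K)%N by rewrite leq_mul2l max_card orbT.
have N_iter i a : N (iter i sg a) = N a by rewrite /N ord_iter.
have swap (F : arr Q -> nat -> k) : \sum_a \sum_(i < (N a).+1) F a i =
    \sum_(i < K.+1) \sum_a (if (i <= N a)%N then F a i else 0).
  rewrite exchange_big; apply: eq_bigr => a _ /=.
  by rewrite (big_ord_widen K.+1 (F a)) ?ltnS // -big_mkcond.
pose F a i := s (iter i sg a) * pcoef x (run (iter i sg a) (N a - i)) *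
  pcoef y (run a i).
pose G a i := s a * pcoef x (run a (N a - i)) *
  pcoef y (run (iter (N a - i) sg a) i).
transitivity (\sum_a \sum_(i < (N a).+1) F a i).
  apply: eq_bigr => a _; rewrite coef_runM mulr_sumr; apply: eq_bigr => i _.
  rewrite [pcoef (sign_twist y) _]/= path_sign_run -!mulrA mulrCA.
  by rewrite [s a * (s a * _)]mulrA sK mul1r mulrCA -/(N a) /F mulrA.
transitivity (\sum_a \sum_(i < (N a).+1) G a i).
  rewrite (swap F) (swap G); apply: eq_bigr => i _.
  rewrite [RHS](reindex_inj (@iter_sigma_inj i)) /=.
  apply: eq_bigr => a _; rewrite /F /G N_iter; case: leqP => // le.
  by rewrite -iterD subnK // iter_ordM.
apply: eq_bigr => a _; rewrite coef_runM mulr_sumr (reindex_inj rev_ord_inj) /=.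
apply: eq_bigr => i _; rewrite /G subSS subKn -1?ltnS // -mulrA.
by congr (_ * _); rewrite mulrC.
Qed.

(** * Nondegeneracy of the form *)

Local Notation Lo := (ribbon_order k gQ).

(** A path longer than every cycle is t times a shorter path, and it determines
    that path. *)
Lemma finite_mod_cyc x : exists y, x - z * y \in @finite_support k Q.
Proof.
have [//|y ey] := @run_coefs (fun a L => if L is 0 then 0 else
  pcoef x (run a (L + ord a))).
exists y; apply/asboolP; exists #|arr Q|.+1 => p.
have [a ->] := run_surj p; rewrite plen_run; set L := plen p => leL.
have lt : (ord a < L)%N by apply: leq_ltn_trans leL; apply: max_card.
rewrite [pcoef _ _]/(pcoef x _ - pcoef (z * y) _) coef_run_cycM ey (ltnW lt).
case: (L - ord a)%N (subnK (ltnW lt)) => [e|n e] /=;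
  last by rewrite e; apply: subrr.
by rewrite -e ltnn in lt.
Qed.

Section Functionals.
Variable f : dual Lo.

Lemma dual0 : f 0 = 0.
Proof. by apply: (addrI (f 0)); rewrite -dual_add !addr0. Qed.

Lemma dualX x : f (z * x) = fpsX k * f x.
Proof. by rewrite -cyc_evalX; apply: (dual_lin f). Qed.

Lemma dualC (c : k) x : f (cyc_eval Q (fpsC c) * x) = fpsC c * f x.
Proof. exact: (dual_lin f). Qed.

Lemma dual_run_shift a M j : (0 < M)%N ->
  f (mono 1 (run a (M + j * ord a))) = fpsX k ^+ j * f (mono 1 (run a M)).
Proof.
move=> M_gt0; elim: j => [|j IHj]; first by rewrite addn0 mul1r.
rewrite exprS -mulrA -IHj -dualX cyc_mono ?ltn_addr //.
by rewrite mulSn [(ord a + _)%N]addnC addnA.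
Qed.

Lemma dual_vertex a : \sum_(b | src b == src a) f (mono 1 (run b (ord b))) =
  fpsX k * f (mono 1 (run a 0)).
Proof.
rewrite -dualX cyc_mono0; apply: esym.
by apply: (big_morph f (dual_add f)); apply: dual0.
Qed.

(** Write x = x0 + t y with x0 a finite combination of paths: f x = t f y, and
    by iteration all coefficients of f x vanish. *)
Lemma dual_eq0 : (forall p, f (mono 1 p) = 0) -> forall x, f x = 0.
Proof.
move=> f0; have f_mono (c : k) p : f (mono c p) = 0.
  suff -> : mono c p = cyc_eval Q (fpsC c) * mono 1 p by rewrite dualC f0 mulr0.
  apply: pseriesP => q; rewrite coef_fpsCM /=.
  by case: eqP; rewrite ?mulr1 ?mulr0.
have f_fin x : x \in @finite_support k Q -> f x = 0.
  move=> fx; have [N e] := pa_expand (PathAlgebra fx).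
  rewrite -[x]/(pa_val (PathAlgebra fx)) e.
  pose K (y : path_algebra k Q) := f (pa_val y) = 0.
  have K0 : K 0 by exact: dual0.
  have KD (y y' : path_algebra k Q) : K y -> K y' -> K (y + y').
    by rewrite /K => ey ey'; rewrite -(addr0 (0 : fps k)) -{1}ey -ey' -dual_add.
  apply: (big_ind K) => // m _; apply: (big_ind K) => // v _.
  apply: (big_ind K) => // w _; rewrite /mono_at.
  by case: {-}_ / idP => // h; apply: f_mono.
suff fm m x : fps_coef (f x) m = 0 by move=> x; apply: fpsP => m; apply: fm.
elim: m x => [|m IHm] x; have [y fin] := finite_mod_cyc x;
  rewrite -[x](subrK (z * y)) dual_add (f_fin _ fin) add0r dualX.
  by rewrite fps_coefXM0.
by rewrite fps_coefXMS.
Qed.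

End Functionals.

Fact form_dual_add (b : Lam) : {morph (fun x => form (x * b)) : x y / x + y}.
Proof. by move=> x y; rewrite mulrDl formD. Qed.

Fact form_dual_lin (b : Lam) r x : form (cyc_eval Q r * x * b) = r * form (x * b).
Proof. by rewrite -mulrA form_linear. Qed.

Definition form_dual (b : Lam) : dual Lo :=
  @Dual _ Lo (fun x => form (x * b)) (form_dual_add b) (form_dual_lin b).

(** For M > 0 the path q = [run (sigma^L a) M] is the only one that completes
    p = [run a L] to the power m + 1 of c_a, and no other product q p' is a
    power m + 1 of a cycle.  Since M > 0, the path q has a first arrow; it
    identifies a, even when p is trivial. *)
Lemma form_run a L m M (b : Lam) : (0 < M)%N -> (L + M = m.+1 * ord a)%N ->
  fps_coef (form (mono 1 (run (iter L sg a) M) * b)) m = s a * pcoef b (run a L).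
Proof.
move=> M_gt0 eLM; rewrite coef_form (big_only1 a) // => [|a' na _].
  have lt : (L < (m.+1 * ord a).+1)%N by rewrite ltnS -eLM leq_addr.
  rewrite coef_runM.
  rewrite (big_only1 (Ordinal lt)) // => [|i ni _] /=.
    by rewrite -eLM addKn eqxx mul1r.
  case: eqP; rewrite ?mul0r // => /esym/(run_inj M_gt0)[_ e].
  case/eqP: ni; apply: val_inj => /=; have := ltn_ord i; lia.
rewrite coef_runM big1 ?mulr0 // => i _ /=.
case: eqP; rewrite ?mul0r // => /esym/(run_inj M_gt0)[ea eM].
have eN : (m.+1 * ord a' = m.+1 * ord a)%N.
  by rewrite -(ord_iter i a') -ea ord_iter.
have ei : i = L :> nat by have := ltn_ord i; lia.
by rewrite ei in ea; rewrite (iter_sigma_inj ea) eqxx in na.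
Qed.

Lemma form_dual_inj : injective form_dual.
Proof.
move=> b b' e; apply: run_ext => a L; pose M := (L.+1 * ord a - L)%N.
have lt : (L < L.+1 * ord a)%N.
  by rewrite (leq_trans (ltnSn L)) // leq_pmulr // ord_gt0.
have M_gt0 : (0 < M)%N by rewrite subn_gt0.
have eM : (L + M = L.+1 * ord a)%N by rewrite subnKC // ltnW.
have eF x : form (x * b) = form (x * b') := congr1 (fun g : dual Lo => g x) e.
rewrite -[LHS]mul1r -[RHS]mul1r -(sK a) -!mulrA; congr (_ * _).
by rewrite -!(form_run _ M_gt0 eM) eF.
Qed.

(** The coefficients that [form_run] forces on b if phi (x b) = f x is to hold for
    all x. *)
Lemma dual_coefs (f : dual Lo) : exists b : Lam, forall a L m M,
  (0 < M)%N -> (L + M = m.+1 * ord a)%N ->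
  pcoef b (run a L) = s a * fps_coef (f (mono 1 (run (iter L sg a) M))) m.
Proof.
(* The power L + 1 of c_a is longer than L, as n(a) > 0. *)
pose M a L := (L.+1 * ord a - L)%N.
pose F a L := s a * fps_coef (f (mono 1 (run (iter L sg a) (M a L)))) L.
have lt a L : (L < L.+1 * ord a)%N.
  by rewrite (leq_trans (ltnSn L)) // leq_pmulr // ord_gt0.
have M_gt0 a L : (0 < M a L)%N by rewrite subn_gt0.
have indep a L m N : (0 < N)%N -> (L + N = m.+1 * ord a)%N ->
    F a L = s a * fps_coef (f (mono 1 (run (iter L sg a) N))) m.
  move=> N_gt0 eN; congr (_ * _).
  have [le|/ltnW le] := leqP m L.
    have -> : M a L = (N + (L - m) * ord (iter L sg a))%N.
      rewrite ord_iter /M; move: le eN (lt a L); nia.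
    by rewrite dual_run_shift // -[X in fps_coef _ X = _](subnKC le) fps_coefXnM.
  have -> : N = (M a L + (m - L) * ord (iter L sg a))%N.
    rewrite ord_iter /M; move: le eN (lt a L); nia.
  by rewrite dual_run_shift // -[X in _ = fps_coef _ X](subnKC le) fps_coefXnM.
have F0 a b : src a = src b -> F a 0 = F b 0.
  move=> eab; rewrite (indep a 0 0 (ord a)) ?ord_gt0 ?mul1n //.
  rewrite (indep b 0 0 (ord b)) ?ord_gt0 ?mul1n //=.
  have [-> //|nab] := eqVneq a b.
  pose g c := fps_coef (f (mono 1 (run c (ord c)))) 0.
  have two (h : arr Q -> k) : \sum_(c | src c == src a) h c = h a + h b.
    have ab : [set c | src c == src a] = [set a; b].
      apply/esym/eqP; rewrite eqEcard two_starting // cards2 nab andbT.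
      by apply/subsetP => c; rewrite !inE => /orP[] /eqP->; rewrite ?eab.
    rewrite (eq_bigl (mem [set a; b])) => [|c]; last by rewrite -ab !inE.
    by rewrite big_setU1 ?inE // big_set1.
  (* The constant term of t f (1_v) = f (c_a) + f (c_b). *)
  have g0 : g a + g b = 0.
    rewrite -two -[RHS](fps_coefXM0 (f (mono 1 (run a 0)))) -dual_vertex.
    by rewrite fps_coef_sum.
  have s0 : s a + s b = 0 by rewrite -two s_vertex.
  have opp (u v : k) : u + v = 0 -> v = - u.
    by move=> uv; apply/eqP; rewrite -addr_eq0 addrC uv.
  by rewrite -/(g a) -/(g b) (opp _ _ g0) (opp _ _ s0) mulrNN.
have [b eb] := run_coefs F0; exists b => a L m N N_gt0 eN.
by rewrite eb; apply: indep.
Qed.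

(** The difference g of both functionals vanishes on a path of length M > 0: its
    coefficient of t^m does so by the choice of b when M <= (m + 1) n(a), and
    otherwise the path is a multiple of t^(m + 1).  A trivial path is reached
    from the two cycles at its vertex, because R has no t-torsion. *)
Lemma form_dual_surj (f : dual Lo) : exists b : Lam, form_dual b = f.
Proof.
have [b hb] := dual_coefs f; exists b; apply/eqP; rewrite -subr_eq0; apply/eqP.
set g := form_dual b - f; apply: dualP; apply: dual_eq0 => p.
have gE x : g x = form (x * b) - f x by [].
have g_run a M : (0 < M)%N -> g (mono 1 (run a M)) = 0.
  move=> M_gt0; apply: fpsP => m; have [le|lt] := leqP M (m.+1 * ord a).
    pose L := (m.+1 * ord a - M)%N; pose a' := iter M sg a.
    have ea : a = iter L sg a' by rewrite -iterD subnK // iter_ordM.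
    have eLM : (L + M = m.+1 * ord a')%N by rewrite ord_iter subnK.
    rewrite ea gE fps_coefB (form_run b M_gt0 eLM) (hb _ _ _ _ M_gt0 eLM).
    by rewrite mulrA sK mul1r subrr.
  rewrite -(subnK (ltnW lt)) dual_run_shift ?subn_gt0 //.
  exact: fps_coefXnM_lt.
have [a ->] := run_surj p; case: (plen p) => [|L]; last exact: g_run.
apply: fpsXI; rewrite mulr0 -dual_vertex big1 // => c _.
by apply: g_run; apply: ord_gt0.
Qed.

Lemma form_dual_linear :
  linear (form_dual : twisted_bimodule ribbon_involution -> canonical_bimodule Lo).
Proof.
move=> a x y; apply: dualP => w.
by rewrite /= mulrDr formD mulrA.
Qed.

Definition form_bimodule_map :
    {linear twisted_bimodule ribbon_involution -> canonical_bimodule Lo} :=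
  HB.pack (form_dual : twisted_bimodule ribbon_involution -> canonical_bimodule Lo)
    (GRing.isLinear.Build _ _ _ *:%R _ form_dual_linear).

Lemma form_dual_ract (b a : Lam) :
  form_dual (@bm_ract _ (twisted_bimodule ribbon_involution) b a) =
  dual_ract (form_dual b) a.
Proof.
by apply: dualP => w /=; rewrite mulrA form_twist mulrA.
Qed.

End Form.
End Coefficients.
End GentlePaths.

Theorem theoremA (k : fieldType) (Q : bound_quiver) (gQ : complete_gentle Q) :
  inhabited (derived_nakayama (ribbon_order k gQ)) /\
  exists e : involution (ribbon_order k gQ),
    forall nu : derived_nakayama (ribbon_order k gQ),
    [/\ functor_iso nu (twist e),
        functor_iso (serre nu) (functor_comp (twist e) (shift (ribbon_order k gQ) 1))
      & functor_iso (functor_comp (serre nu) (serre nu))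
                    (shift (ribbon_order k gQ) 2)].
Proof.
have [s [sK s0]] := vertex_signs gQ k.
pose e := ribbon_involution gQ sK.
pose th := form_bimodule_map gQ sK s0.
have thR b a : th (bm_ract b a) = bm_ract (th b) a by apply: form_dual_ract.
have surj (f : dual (ribbon_order k gQ)) := cid (form_dual_surj sK s0 f).
pose ps f := sval (surj f).
have psK : cancel ps th by move=> f; apply: (svalP (surj f)).
have thK : cancel th ps.
  by move=> b; apply: (@form_dual_inj _ _ _ _ sK s0); apply: (psK (th b)).
split; first exact: derived_nakayama_exists thR thK psK.
exists e => nu; split.
- exact: derived_nakayama_twist thR thK psK nu.
- exact: serre_twist thR thK psK nu.
- exact: serre_square thR thK psK nu.
Qed.
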